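(* Let $(\bar\partial,\Phi)$ be a stable complex variation of Hodge structures on $\Sigma$ (a $\mathbb C^*$-fixed stable $\mathrm{SL}(n,\mathbb C)$-Higgs bundle) and let $(\beta,\phi)\in\mathcal B^+_{(\bar\partial,\Phi)}$. Write $\beta=\sum_{j=1}^l\beta_j$ with $\beta_j\in\Omega^{0,1}(\mathfrak{sl}(E)_j)$ and $\phi=\sum_{j=0}^l\phi_j$ with $\phi_j\in\Omega^{1,0}(\mathfrak{sl}(E)_j)$. Then over $\mathbb C\subset\mathbb{CP}^1$ the $\mathbb C^*$-fixed section $s_{(\beta,\phi)}$ may be expressed as $$s_{(\beta,\phi)}(\lambda)=\Big[\lambda,\ \bar\partial+\lambda(\Phi^{*_h}+\beta_1)+\sum_{j=2}^l\lambda^j\beta_j,\ \Phi+\lambda\partial^h+\sum_{j=0}^l\lambda^{j+1}\phi_j\Big].$$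
   Context: Let $\Sigma$ be a compact Riemann surface of genus at least two and $E\to\Sigma$ a smooth rank $n$ vector bundle of degree $0$ with structure group $\mathrm{SU}(n)$; $\mathfrak{sl}(E)$ is the bundle of trace-free endomorphisms. An $\mathrm{SL}(n,\mathbb C)$ $\lambda$-connection ($\lambda\in\mathbb C$) is a pair $(\bar\partial,D)$ of a holomorphic structure on $E$ and a first-order operator $D\colon\Gamma(E)\to\Omega^{1,0}(E)$ with $D(fs)=\lambda\,\partial f\otimes s+fDs$, $\bar\partial D+D\bar\partial=0$, inducing the trivial structure and $\lambda\partial_\Sigma$ on $\Lambda^nE$. It is stable if every $D$-invariant holomorphic proper subbundle has negative degree, polystable if a direct sum of stable ones of degree $0$. For $\lambda=0$ it is a Higgs bundle $(\bar\partial,\Phi)$. $\mathcal M_{\mathrm{Hod}}(\Sigma)$ is the moduli space of triples $(\lambda,\bar\partial,D)$ with $(\bar\partial,D)$ polystable, modulo $\Gamma(\Sigma,\mathrm{SL}(E))$; $\mathbb C^*$ acts by $\zeta\cdot[\lambda,\bar\partial,D]=[\zeta\lambda,\bar\partial,\zeta D]$. The Deligne–Hitchin moduli space $\mathcal M_{\mathrm{DH}}$ is obtained by gluing $\mathcal M_{\mathrm{Hod}}(\Sigma)$ and $\mathcal M_{\mathrm{Hod}}(\overline\Sigma)$ over $\mathbb C^*$ via $[\lambda,\bar\partial,D]\sim[\lambda^{-1},\lambda^{-1}D,\lambda^{-1}\bar\partial]$; it has a $\mathbb C^*$-equivariant projection $\varpi\colon\mathcal M_{\mathrm{DH}}\to\mathbb{CP}^1$.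 A reductive flat connection $\nabla=\bar\partial^\nabla+\partial^\nabla$ defines a $\mathbb C^*$-fixed section $s_\nabla$ of $\varpi$: $s_\nabla(\lambda)=[\lambda,\bar\partial^\nabla,\lambda\partial^\nabla]$ for $\lambda\in\mathbb C^*$, extended over $0,\infty$ by taking limits (which exist by Simpson). A stable $\mathbb C^*$-fixed Higgs bundle $(\bar\partial,\Phi)$ (complex variation of Hodge structures) has a holomorphic splitting $E=\bigoplus_{j=1}^lE_j$ with $\bar\partial$ diagonal and $\Phi=\sum_j\Phi^{(j)}$, $\Phi^{(j)}\in H^0(\Sigma,\mathrm{Hom}(E_j,E_{j+1})\otimes K_\Sigma)$. Set $\mathfrak{sl}(E)_k=\{\psi\in\mathfrak{sl}(E)\mid\psi(E_i)\subset E_{i-k}\ \forall i\}$, $N_+=\bigoplus_{k>0}\mathfrak{sl}(E)_k$, $\mathbb L=\mathfrak{sl}(E)_0$. Let $h$ be its harmonic metric (for which the $E_j$ are orthogonal), $\partial^h$ the $(1,0)$-part of the Chern connection, $\Phi^{*_h}$ the adjoint, so that $\bar\partial+\partial^h+\Phi+\Phi^{*_h}$ is flat. The BB-slice is $$\mathcal B^+_{(\bar\partial,\Phi)}=\{(\beta,\phi)\in\Omega^{0,1}(N_+)\oplus\Omega^{1,0}(\mathbb L\oplus N_+)\mid\bar\partial\phi+[(\Phi+\phi)\wedge\beta]=0,\ \partial^h\beta+[\Phi^{*_h}\wedge\phi]=0\}.$$ For $(\beta,\phi)\in\mathcal B^+_{(\bar\partial,\Phi)}$, the connection $\nabla=\bar\partial+\Phi^{*_h}+\beta+\partial^h+\Phi+\phi$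 is flat and irreducible (Collier–Wentworth), and $s_{(\beta,\phi)}:=s_\nabla$. *)

(* Defs.v *)
From Stdlib Require List.
From HB Require Import structures.
From mathcomp Require Import all_boot all_order all_algebra.
From mathcomp Require Import all_classical all_reals all_analysis.
From mathcomp Require Import complex.

Set Implicit Arguments.
Unset Strict Implicit.
Unset Printing Implicit Defensive.

Import Order.TTheory GRing.Theory Num.Theory.
Import numFieldNormedType.Exports.

Local Open Scope classical_set_scope.
Local Open Scope ring_scope.
Local Open Scope complex_scope.

Section PlaneCalculus.
Context {R : realType}.

(* Points of C are stored as pairs (x, y), so that partial derivatives and
   Lebesgue measure are the ones of the real plane. *)
Definition cplx (p : R * R) : R[i] := p.1 +i* p.2.

Definition axis (b : bool) : R * R := if b then (0, 1) else (1, 0).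

Definition iter_partial (w : seq bool) (u : R * R -> R) : R * R -> R :=
  foldr (fun b (v : R * R -> R) => (fun p => 'D_(axis b) v p)) u w.

Definition real_smooth_on (V : set (R * R)) (u : R * R -> R) : Prop :=
  forall (w : seq bool) p, V p ->
    {for p, continuous (iter_partial w u)} /\
    (forall b, derivable (iter_partial w u) p (axis b)).

Definition smooth_on (V : set (R * R)) (f : R * R -> R[i]) : Prop :=
  real_smooth_on V (fun p => complex.Re (f p)) /\
  real_smooth_on V (fun p => complex.Im (f p)).

Definition iter_partialC (w : seq bool) (f : R * R -> R[i]) (p : R * R) : R[i] :=
  iter_partial w (fun q => complex.Re (f q)) p +i*
  iter_partial w (fun q => complex.Im (f q)) p.

Definition wirtinger (f : R * R -> R[i]) (p : R * R) : R[i] :=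
  (iter_partialC [:: false] f p - 'i * iter_partialC [:: true] f p) / 2.

Definition wirtinger_bar (f : R * R -> R[i]) (p : R * R) : R[i] :=
  (iter_partialC [:: false] f p + 'i * iter_partialC [:: true] f p) / 2.

End PlaneCalculus.

(* [crd i] is a coordinate on the open set [dom i] and [par i] is its inverse;
   their values elsewhere are irrelevant. *)
Record riemann_surface (R : realType) := RiemannSurface {
  carrier :> topologicalType ;
  chart : Type ;
  dom : chart -> set carrier ;
  crd : chart -> carrier -> R * R ;
  par : chart -> R * R -> carrier ;
  rs_hausdorff : hausdorff_space carrier ;
  rs_connected : connected [set: carrier] ;
  rs_cover : forall x, exists i, dom i x ;
  rs_dom_open : forall i, open (dom i) ;
  rs_img_open : forall i, open (crd i @` dom i) ;
  rs_crdK : forall i x, dom i x -> par i (crd i x) = x ;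
  rs_crd_cont : forall i x, dom i x -> {for x, continuous (crd i)} ;
  rs_par_cont : forall i p, (crd i @` dom i) p -> {for p, continuous (par i)} ;
  rs_holo : forall i j (V := crd i @` (dom i `&` dom j))
      (f := fun p => cplx (crd j (par i p))),
    smooth_on V f /\ forall p, V p -> wirtinger_bar f p = 0 }.

Arguments dom {R X} : rename.
Arguments crd {R X} : rename.
Arguments par {R X} : rename.

Section SurfaceCalculus.
Context {R : realType} {X : riemann_surface R}.
Implicit Types (i j : chart X) (x : X).

Definition smooth_in i (D : set X) (f : X -> R[i]) : Prop :=
  smooth_on (crd i @` D) (fun p => f (par i p)).

Definition dz i (f : X -> R[i]) x : R[i] :=
  wirtinger (fun p => f (par i p)) (crd i x).

Definition dzbar i (f : X -> R[i]) x : R[i] :=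
  wirtinger_bar (fun p => f (par i p)) (crd i x).

(* dz_j / dz_i *)
Definition jac i j x : R[i] := dz i (fun y => cplx (crd j y)) x.

Definition holomorphic_form (w : chart X -> X -> R[i]) : Prop :=
  (forall i, smooth_in i (dom i) (w i)) /\
  (forall i x, dom i x -> dzbar i (w i) x = 0) /\
  (forall i j x, dom i x -> dom j x -> w i x = jac i j x * w j x).

(* genus = dim H^0(X, K_X) *)
Definition genus_ge (g : nat) : Prop :=
  exists w : 'I_g -> chart X -> X -> R[i],
    (forall a, holomorphic_form (w a)) /\
    forall c : 'I_g -> R[i],
      (forall i x, dom i x -> \sum_a c a * w a i x = 0) -> forall a, c a = 0.

(* A cutting of X into finitely many Borel pieces, each one relatively compact
   in a chart. *)
Definition dissection m (c : 'I_m -> chart X) (S : 'I_m -> set X) : Prop :=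
  [/\ \bigcup_k S k = [set: X],
      trivIset [set: 'I_m] S,
      forall k, S k `<=` dom (c k),
      forall k, measurable
        (crd (c k) @` S k : set (measurableTypeR R * measurableTypeR R)) &
      forall k, exists K : set (R * R), [/\ compact K,
        K `<=` crd (c k) @` dom (c k) & crd (c k) @` S k `<=` K] ].

(* The integral over X of the 2-form given by [w i dx_i /\ dy_i] on [dom i]. *)
Definition integral2 (w : chart X -> X -> R) : R :=
  xget 0 [set v | exists m (c : 'I_m -> chart X) (S : 'I_m -> set X),
    dissection c S /\
    v = \sum_k Rintegral (lebesgue_measure \x lebesgue_measure)%E
          (crd (c k) @` S k) (fun p => w (c k) (par (c k) p))].

Section Matrices.
Context {m n : nat}.
Implicit Types M : X -> 'M[R[i]]_(m, n).

Definition smooth_mx i (D : set X) M : Prop :=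
  forall a b, smooth_in i D (fun y => M y a b).

Definition dz_mx i M x : 'M[R[i]]_(m, n) :=
  \matrix_(a, b) dz i (fun y => M y a b) x.

Definition dzbar_mx i M x : 'M[R[i]]_(m, n) :=
  \matrix_(a, b) dzbar i (fun y => M y a b) x.

End Matrices.
End SurfaceCalculus.

Arguments genus_ge {R} X g.

Definition lie {K : pzRingType} {n : nat} (A B : 'M[K]_n) : 'M[K]_n :=
  A *m B - B *m A.

Local Notation "M ^t*" := (map_mx Num.conj (trmx M)) : ring_scope.

(* A smooth bundle with structure group SU(n), trivialised over the charts of
   the atlas (which may be chosen fine enough): local components of a section
   satisfy [s_i = trans i j *m s_j].  Its determinant is trivialised, so its
   degree is 0. *)
Record su_bundle (R : realType) (X : riemann_surface R) (n : nat) := SUBundle {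
  trans : chart X -> chart X -> X -> 'M[R[i]]_n ;
  trans_smooth : forall i j, smooth_mx i (dom i `&` dom j) (trans i j) ;
  trans_unitary : forall i j x, dom i x -> dom j x ->
    (trans i j x)^t* *m trans i j x = 1%:M ;
  trans_det : forall i j x, dom i x -> dom j x -> \det (trans i j x) = 1 ;
  trans_cocycle : forall i j k x, dom i x -> dom j x -> dom k x ->
    trans i j x *m trans j k x = trans i k x }.

Section Bundles.
Context {R : realType} {X : riemann_surface R} {n : nat}.

(* Families of matrix-valued functions, one per chart; only the values of the
   i-th member on [dom i] are meaningful. *)
Definition coefs : Type := chart X -> X -> 'M[R[i]]_n.

Context (E : su_bundle X n).
Implicit Types (i j : chart X) (x : X) (s A B Psi p q h : coefs).

Definition smooth_coefs s : Prop := forall i, smooth_mx i (dom i) (s i).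

Definition is_endo s : Prop :=
  smooth_coefs s /\
  forall i j x, dom i x -> dom j x ->
    s i x *m trans E i j x = trans E i j x *m s j x.

(* The End(E)-valued form equal to [Psi i dz_i] on [dom i]. *)
Definition is_form10 Psi : Prop :=
  smooth_coefs Psi /\
  forall i j x, dom i x -> dom j x ->
    Psi i x *m trans E i j x = jac i j x *: (trans E i j x *m Psi j x).

(* The End(E)-valued form equal to [Psi i dzbar_i] on [dom i]. *)
Definition is_form01 Psi : Prop :=
  smooth_coefs Psi /\
  forall i j x, dom i x -> dom j x ->
    Psi i x *m trans E i j x =
    Num.conj (jac i j x) *: (trans E i j x *m Psi j x).

(* The operator D : Gamma(E) -> Omega^{1,0}(E) with
   D(fs) = lam df s + f Ds which reads [dz_i (lam d/dz_i + B i)]. *)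
Definition is_operator10 (lam : R[i]) B : Prop :=
  smooth_coefs B /\
  forall i j x, dom i x -> dom j x ->
    B i x *m trans E i j x =
    jac i j x *: (trans E i j x *m B j x) - lam *: dz_mx i (trans E i j) x.

(* The operator Gamma(E) -> Omega^{0,1}(E) which reads
   [dzbar_i (d/dzbar_i + A i)]. *)
Definition is_operator01 A : Prop :=
  smooth_coefs A /\
  forall i j x, dom i x -> dom j x ->
    A i x *m trans E i j x =
    Num.conj (jac i j x) *: (trans E i j x *m A j x) - dzbar_mx i (trans E i j) x.

(* The coefficients of [dz, .] and [dbar, .] acting on sections of End(E). *)
Definition end10 (lam : R[i]) B s : coefs :=
  fun i x => lam *: dz_mx i (s i) x + lie (B i x) (s i x).

Definition end01 A s : coefs :=
  fun i x => dzbar_mx i (s i) x + lie (A i x) (s i x).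

(* The coefficient of dzbar /\ dz in  dbar D + D dbar. *)
Definition curvature (lam : R[i]) A B : coefs :=
  fun i x => dzbar_mx i (B i) x - lam *: dz_mx i (A i) x + lie (A i x) (B i x).

(* A smooth subbundle of E is encoded as the image of a smooth idempotent
   section of End(E). *)
Definition is_projector p : Prop :=
  is_endo p /\ forall i x, dom i x -> p i x *m p i x = p i x.

(* (1/2pi) sqrt(-1) times the trace of the curvature of the connection induced
   on im p by an arbitrary smooth connection (A, B) of E, as a multiple of
   dx /\ dy.  The induced connection p o nabla has curvature
   p (F + nabla p /\ nabla p), F is [- curvature 1 A B] times dz /\ dzbar, and
   dz /\ dzbar = - 2 sqrt(-1) dx /\ dy. *)
Definition chern_density A B p : chart X -> X -> R :=
  fun i x => (trigo.pi)^-1 * complex.Re (\tr (p i x *m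
    (lie (end10 1 B p i x) (end01 A p i x) - curvature 1 A B i x))).

Definition has_degree p (d : R) : Prop :=
  exists A B, [/\ is_operator01 A, is_operator10 1 B &
                  d = integral2 (chern_density A B p)].

Record lconn := LConn { lam : R[i] ; c01 : coefs ; c10 : coefs }.

(* Since [trans] has values in SU(n), the structures induced on Lambda^n E are
   the trivial ones exactly when the local coefficients are trace-free. *)
Definition is_lconn (c : lconn) : Prop :=
  [/\ is_operator01 (c01 c), is_operator10 (lam c) (c10 c),
      forall i x, dom i x -> \tr (c01 c i x) = 0 /\ \tr (c10 c i x) = 0 &
      forall i x, dom i x -> curvature (lam c) (c01 c) (c10 c) i x = 0].

(* im p is a holomorphic, D-invariant subbundle. *)
Definition invariant_subbundle (c : lconn) p : Prop :=
  is_projector p /\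
  forall i x, dom i x ->
    (1%:M - p i x) *m (dzbar_mx i (p i) x + c01 c i x *m p i x) = 0 /\
    (1%:M - p i x) *m (lam c *: dz_mx i (p i) x + c10 c i x *m p i x) = 0.

Definition proper_subbundle q p : Prop :=
  forall i x, dom i x ->
    [/\ p i x *m q i x = q i x, (0 < \rank (q i x))%N &
        (\rank (q i x) < \rank (p i x))%N].

(* Stability of the restriction of c to the degree 0 subbundle im p. *)
Definition stable_on (c : lconn) p : Prop :=
  forall q, invariant_subbundle c q -> proper_subbundle q p ->
    exists2 d : R, has_degree q d & d < 0.

Definition stable (c : lconn) : Prop := stable_on c (fun _ _ => 1%:M).

(* E is the direct sum of the nonzero subbundles im (p k), all of which are
   holomorphic and D-invariant. *)
Definition direct_sum (c : lconn) m (p : 'I_m -> coefs) : Prop :=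
  (forall k, is_endo (p k)) /\
  forall i x, dom i x ->
    [/\ forall k, (0 < \rank (p k i x))%N,
        forall k k', p k i x *m p k' i x = if k == k' then p k i x else 0,
        \sum_k p k i x = 1%:M,
        forall k, end01 (c01 c) (p k) i x = 0 &
        forall k, end10 (lam c) (c10 c) (p k) i x = 0].

Definition polystable (c : lconn) : Prop :=
  exists m (p : 'I_m -> coefs), direct_sum c p /\
    forall k, has_degree (p k) 0 /\ stable_on c (p k).

(* A connection is a lambda-connection with lam = 1; it is reductive when it is
   a direct sum of irreducible ones. *)
Definition reductive (c : lconn) : Prop :=
  lam c = 1 /\ exists m (p : 'I_m -> coefs), direct_sum c p /\
    forall k q, invariant_subbundle c q -> ~ proper_subbundle q (p k).

(* Equivalence under Gamma(X, SL(E)), acting by conjugation on operators. *)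
Definition gauge_equiv (c c' : lconn) : Prop :=
  lam c' = lam c /\
  exists g : coefs, [/\ is_endo g,
    forall i x, dom i x -> \det (g i x) = 1,
    forall i x, dom i x ->
      c01 c' i x *m g i x = g i x *m c01 c i x - dzbar_mx i (g i) x &
    forall i x, dom i x ->
      c10 c' i x *m g i x = g i x *m c10 c i x - lam c *: dz_mx i (g i) x].

Definition plconn : Type := {c : lconn | is_lconn c /\ polystable c}.

(* Uniform closeness up to eps, of lam and of finitely many partial derivatives
   of the coefficients on compact subsets of charts; the partial derivatives are
   indexed by words.  These are the basic neighbourhoods of the C^infinity
   topology. *)
Definition cinf_ball (L : seq (chart X * set (R * R) * seq bool)) (eps : R)
    (c c' : lconn) : Prop :=
  `|lam c' - lam c| < eps%:C /\
  forall i K w, List.In (i, K, w) L -> forall y a b, K y ->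
    `|iter_partialC w (fun z => (c01 c' i (par i z) - c01 c i (par i z)) a b) y|
      < eps%:C /\
    `|iter_partialC w (fun z => (c10 c' i (par i z) - c10 c i (par i z)) a b) y|
      < eps%:C.

Definition compacts_in_charts (L : seq (chart X * set (R * R) * seq bool)) :=
  forall i K w, List.In (i, K, w) L -> compact K /\ K `<=` crd i @` dom i.

Definition cinf_open (W : set plconn) : Prop :=
  forall c, W c -> exists L (eps : R), [/\ compacts_in_charts L, 0 < eps &
    forall c' : plconn, cinf_ball L eps (sval c) (sval c') -> W c'].

Lemma cinf_openT : cinf_open setT.
Proof. by move=> c _; exists [::], 1. Qed.

Lemma cinf_openI (U V : set plconn) :
  cinf_open U -> cinf_open V -> cinf_open (U `&` V).
Proof.
move=> oU oV c [Uc Vc].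
have [L1 [e1 [K1 e1gt0 H1]]] := oU c Uc; have [L2 [e2 [K2 e2gt0 H2]]] := oV c Vc.
exists (L1 ++ L2)%SEQ, (Num.min e1 e2); split.
- by move=> i K w HI; case: (List.in_app_or _ _ _ HI) => {}HI;
    [exact: (K1 _ _ w) | exact: (K2 _ _ w)].
- by rewrite lt_min e1gt0.
- move=> c' [Hlam HL].
  have le1 : (Num.min e1 e2)%:C <= e1%:C by rewrite lecR ge_min lexx.
  have le2 : (Num.min e1 e2)%:C <= e2%:C by rewrite lecR ge_min lexx orbT.
  have HL' d i K w : List.In (i, K, w) (L1 ++ L2)%SEQ -> (Num.min e1 e2)%:C <= d%:C ->
      forall y a b, K y -> _ := fun HI led y a b Ky =>
    let: conj P1 P2 := HL i K w HI y a b Ky in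
    conj (lt_le_trans P1 led) (lt_le_trans P2 led).
  split; [apply: H1 | apply: H2]; (split; first exact: lt_le_trans Hlam _).
  + by move=> i K w HI; apply: HL' => //; apply: List.in_or_app; left.
  + by move=> i K w HI; apply: HL' => //; apply: List.in_or_app; right.
Qed.

Lemma cinf_open_bigcup (I : Type) (f : I -> set plconn) :
  (forall t, cinf_open (f t)) -> cinf_open (\bigcup_t f t).
Proof.
move=> of_ c [t _ ftc]; have [L [eps [HL e0 H]]] := of_ t c ftc.
by exists L, eps; split => // c' /H ftc'; exists t.
Qed.

Definition gauge_class (c : plconn) : set plconn :=
  [set c' | gauge_equiv (sval c) (sval c')].

Definition MHod : Type := {k : set plconn | exists c, k = gauge_class c}.

Definition hod_class (c : plconn) : MHod :=
  exist _ (gauge_class c) (ex_intro _ c erefl).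

HB.instance Definition _ := gen_eqMixin MHod.
HB.instance Definition _ := gen_choiceMixin MHod.

Definition hod_open (W : set MHod) : Prop := cinf_open (hod_class @^-1` W).

Lemma hod_openT : hod_open setT.
Proof. exact: cinf_openT. Qed.

Lemma hod_openI (U V : set MHod) :
  hod_open U -> hod_open V -> hod_open (U `&` V).
Proof. exact: cinf_openI. Qed.

Lemma hod_open_bigcup (I : Type) (f : I -> set MHod) :
  (forall t, hod_open (f t)) -> hod_open (\bigcup_t f t).
Proof. by move=> of_; rewrite /hod_open preimage_bigcup; exact: cinf_open_bigcup. Qed.

HB.instance Definition _ :=
  isOpenTopological.Build MHod hod_openT hod_openI hod_open_bigcup.

(* P is the point [lam, dbar, D]; in particular (lam, dbar, D) is a polystable
   lambda-connection. *)
Definition hod_point (P : MHod) (c : lconn) : Prop :=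
  exists Hc : is_lconn c /\ polystable c, P = hod_class (exist _ c Hc).

(* The restriction to C of the section s_nabla of the Deligne--Hitchin space:
   s(mu) = [mu, dbar^nabla, mu del^nabla] for mu <> 0, and s(0) = lim s(mu). *)
Definition is_nabla_section (nabla : lconn) (s : R[i] -> MHod) : Prop :=
  (forall mu, mu != 0 ->
    hod_point (s mu)
      (LConn mu (c01 nabla) (fun i x => mu *: c10 nabla i x))) /\
  s mu @[mu --> (0 : R[i]^o)^'] --> s 0.

(* The components of degree k in K of the grading of sl(E) induced by the
   splitting E = sum_a im (P a):  psi(E_a) is contained in the sum of the
   E_{a-k}, for k in K.  Also used for forms, through their coefficients. *)
Definition in_sl l (P : 'I_l -> coefs) (K : pred int) (psi : coefs) : Prop :=
  forall i x, dom i x -> \tr (psi i x) = 0 /\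
    forall a b : 'I_l, ~~ K ((a : nat)%:Z - (b : nat)%:Z) ->
      P b i x *m psi i x *m P a i x = 0.

(* A stable C^*-fixed Higgs bundle (A, Phi), with its splitting into the
   E_a = im (P a). *)
Definition is_stable_VHS l (P : 'I_l -> coefs) (A Phi : coefs) : Prop :=
  [/\ is_lconn (LConn 0 A Phi),
      stable (LConn 0 A Phi),
      forall zeta : R[i], zeta != 0 ->
        gauge_equiv (LConn 0 A Phi) (LConn 0 A (fun i x => zeta *: Phi i x)),
      (forall a, is_endo (P a)) /\
      (forall i x, dom i x ->
        [/\ forall a, (0 < \rank (P a i x))%N,
            forall a b, P a i x *m P b i x = if a == b then P a i x else 0,
            \sum_a P a i x = 1%:M &
            forall a, end01 A (P a) i x = 0]) &
      forall i x, dom i x -> forall a b : 'I_l, (b : nat) != a.+1 ->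
        P b i x *m Phi i x *m P a i x = 0].

(* Hermitian metrics <u, v> = v^* h u of determinant 1. *)
Definition is_metric h : Prop :=
  [/\ smooth_coefs h,
      forall i x, dom i x ->
        [/\ (h i x)^t* = h i x, \det (h i x) = 1 &
            forall v : 'cV[R[i]]_n, v != 0 -> 0 < ((v^t* *m h i x *m v) 0 0)] &
      forall i j x, dom i x -> dom j x ->
        (trans E i j x)^t* *m h i x *m trans E i j x = h j x].

(* The coefficient of the (1,0)-part of the Chern connection of (A, h),
   determined by  d/dz <u, v> = <del^h u, v> + <u, dbar v>. *)
Definition chern10 A h : coefs :=
  fun i x => invmx (h i x) *m (dz_mx i (h i) x - (A i x)^t* *m h i x).

(* The coefficient of the h-adjoint (0,1)-form of [Phi dz]. *)
Definition adj_h h Phi : coefs :=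
  fun i x => invmx (h i x) *m (Phi i x)^t* *m h i x.

(* dbar + del^h + Phi + Phi^{*_h} is flat and the E_a are h-orthogonal. *)
Definition is_harmonic_metric l (P : 'I_l -> coefs) A Phi h : Prop :=
  [/\ is_metric h,
      forall i x, dom i x ->
        curvature 1 (fun i x => A i x + adj_h h Phi i x)
          (fun i x => chern10 A h i x + Phi i x) i x = 0 &
      forall i x, dom i x -> forall a b, a != b ->
        (P a i x)^t* *m h i x *m P b i x = 0].

(* The two equations are the coefficients of dzbar /\ dz and dz /\ dzbar. *)
Definition in_BB_slice l (P : 'I_l -> coefs) A Phi h (beta phi : coefs) : Prop :=
  [/\ is_form01 beta /\ in_sl P (fun k => 0 < k) beta,
      is_form10 phi /\ in_sl P (fun k => 0 <= k) phi,
      forall i x, dom i x ->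
        end01 A phi i x - lie (Phi i x + phi i x) (beta i x) = 0 &
      forall i x, dom i x ->
        end10 1 (chern10 A h) beta i x - lie (adj_h h Phi i x) (phi i x) = 0].

(* dbar + Phi^{*_h} + beta + del^h + Phi + phi *)
Definition slice_connection A Phi h (beta phi : coefs) : lconn :=
  LConn 1 (fun i x => A i x + adj_h h Phi i x + beta i x)
          (fun i x => chern10 A h i x + Phi i x + phi i x).

End Bundles.

Arguments coefs {R} X n.
Arguments MHod {R X n} E.

(* Main.v *)
(* The splitting E = sum_a E_a gives, for lambda <> 0, the gauge transformation
   g = c * sum_a lambda^-a P_a, where the constant c makes det g = 1.  Since the
   P_a are parallel for dbar + del^h, conjugating the lambda-connection
   (dbar^nabla, lambda del^nabla) by g only multiplies the component of degree k
   of each matrix-valued form by lambda^k, which turns it into the family of the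
   statement.  The family is polynomial in lambda with value (dbar, Phi) at 0, so
   it converges to it in the C^infinity topology. *)

Require Import Defs.
From HB Require Import structures.
From mathcomp Require Import all_boot all_order all_algebra perm.
From mathcomp Require Import all_classical all_reals all_analysis.
From mathcomp Require Import complex ring lra.

Set Implicit Arguments.
Unset Strict Implicit.
Unset Printing Implicit Defensive.

Import Order.TTheory GRing.Theory Num.Theory.
Import numFieldNormedType.Exports.

Local Open Scope classical_set_scope.
Local Open Scope ring_scope.
Local Open Scope complex_scope.

Local Notation "M ^t*" := (map_mx Num.conj (trmx M)) : ring_scope.
(** * Smooth functions on the plane *)

(** The obstacle is polystability. A point of the moduli space must be polystable, and a degree is
    an integral attached to a connection, so degrees are never moved through a gauge transformation.
    What is moved is a degree-free condition, a decomposition into irreducible summands; for lambda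
    <> 0 the degrees are then 0 because dividing D by lambda gives a flat connection preserving the
    summands. At lambda = 0 stability is given, and E has degree 0 by the flat connection of the
    slice. The P_a are dbar-parallel; orthogonality makes them self-adjoint, and the adjoint of dbar
    P_a = 0 is del^h P_a = 0. Phi has degree -1, so conjugation cancels the factor lambda in front
    of it; its adjoint has degree 1, which is why it stands next to beta_1. The constant c is an
    n-th root of the inverse of det (sum_a lambda^-a P_a), which is constant because it is the
    determinant of a parallel section on a connected surface. Flatness passes to the conjugate
    because the curvature of dbar + del^h is a commutator of Phi and its adjoint: it has degree 0,
    hence commutes with g. *)

Section RealSmooth.
Context {R : realType}.
Implicit Types (V : set (R * R)) (u v : R * R -> R) (w : seq bool).

(** The head of a word is the outermost derivative, so the last letter is the innermost one and can
    be handed over to [u]. *)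
Lemma iter_partial_rcons w b u :
  iter_partial (rcons w b) u = iter_partial w (iter_partial [:: b] u).
Proof. by rewrite /iter_partial foldr_rcons. Qed.

Lemma eq_iter_partial V u v w : open V -> (forall p, V p -> u p = v p) ->
  forall p, V p -> iter_partial w u p = iter_partial w v p.
Proof.
move=> oV uv; elim: w => [//|b w IH] p Vp /=.
by apply: near_eq_derive; near=> q; apply: IH; near: q; exact: open_nbhs_nbhs.
Unshelve. all: by end_near. Qed.

(** Truncating smoothness at order [k] makes induction on the order possible: order k + 1 is order 0
    together with order k for the two partial derivatives. The Leibniz rule needs this. *)
Definition smooth_upto k V u := forall w, (size w <= k)%N -> forall p, V p ->
  {for p, continuous (iter_partial w u)} /\
  forall b, derivable (iter_partial w u) p (axis b).

Lemma smooth_uptoP V u : real_smooth_on V u <-> forall k, smooth_upto k V u.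
Proof.
split=> [su k w _ p Vp|su w p Vp]; first exact: su.
exact: su (leqnn _) p Vp.
Qed.

Lemma eq_smooth_upto k V u v : open V -> (forall p, V p -> u p = v p) ->
  smooth_upto k V u -> smooth_upto k V v.
Proof.
move=> oV uv su w wk p Vp; have [cu du] := su w wk p Vp.
have nuv : \forall q \near p, iter_partial w u q = iter_partial w v q.
  by near=> q; apply: (eq_iter_partial (V := V)) => //; near: q; exact: open_nbhs_nbhs.
split=> [|b]; last exact: near_eq_derivable (du b).
rewrite /prop_for /continuous_at -(nbhs_singleton nuv).
by apply: cvg_trans cu; apply: near_eq_cvg.
Unshelve. all: by end_near. Qed.

Lemma smooth_uptoW k m V u : (k <= m)%N -> smooth_upto m V u -> smooth_upto k V u.
Proof. by move=> km su w wk; apply: su; apply: leq_trans km. Qed.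

Lemma smooth_upto_partial k V u (b : bool) :
  smooth_upto k.+1 V u -> smooth_upto k V (iter_partial [:: b] u).
Proof. by move=> su w wk; rewrite -iter_partial_rcons; apply: su; rewrite size_rcons. Qed.
Arguments smooth_upto_partial {k V u} b.

Lemma smooth_uptoS k V u : smooth_upto 0 V u ->
  (forall b, smooth_upto k V (iter_partial [:: b] u)) -> smooth_upto k.+1 V u.
Proof.
move=> s0 s1 w; case/lastP: w => [_|w b]; first exact: (s0 [::]).
by rewrite size_rcons ltnS iter_partial_rcons => wk; exact: s1.
Qed.

(** The bound is [k.+1] because order [k] includes derivability of the partial derivatives of length
    [k]. *)
Lemma iter_partial_lin k V (a : R) u v w : open V ->
  smooth_upto k V u -> smooth_upto k V v -> (size w <= k.+1)%N ->
  forall p, V p -> iter_partial w (fun q => a * u q + v q) p =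
    a * iter_partial w u p + iter_partial w v p.
Proof.
move=> oV su sv; elim: w => [//|b w IH] wk p Vp /=.
rewrite ltnS in wk; have [_ du] := su w wk p Vp; have [_ dv] := sv w wk p Vp.
transitivity ('D_(axis b) (a *: iter_partial w u + iter_partial w v) p).
  apply: near_eq_derive; near=> q; apply: IH; first exact: leqW.
  by near: q; exact: open_nbhs_nbhs.
by rewrite deriveD ?deriveZ//; exact: derivableZ.
Unshelve. all: by end_near. Qed.

Lemma smooth_upto_lin k V (a : R) u v : open V ->
  smooth_upto k V u -> smooth_upto k V v ->
  smooth_upto k V (fun q => a * u q + v q).
Proof.
move=> oV su sv w wk p Vp.
have [cu du] := su w wk p Vp; have [cv dv] := sv w wk p Vp.
have e : \forall q \near p, (a *: iter_partial w u + iter_partial w v) q =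
    iter_partial w (fun q => a * u q + v q) q.
  near=> q; rewrite (@iter_partial_lin k V)//; first exact: leqW.
  by near: q; exact: open_nbhs_nbhs.
split=> [|b].
  rewrite /prop_for /continuous_at -(nbhs_singleton e).
  apply: (@cvg_trans _ ((a *: iter_partial w u + iter_partial w v) @ p)).
    exact: near_eq_cvg.
  by apply: cvgD cv; apply: cvgZr cu.
have dl : derivable (a *: iter_partial w u + iter_partial w v) p (axis b).
  by apply: derivableD => //; exact: derivableZ.
exact: near_eq_derivable e dl.
Unshelve. all: by end_near. Qed.

Lemma partialM V u v b p : smooth_upto 0 V u -> smooth_upto 0 V v -> V p ->
  iter_partial [:: b] (fun q => u q * v q) p =
  u p * iter_partial [:: b] v p + v p * iter_partial [:: b] u p.
Proof.
move=> su sv Vp; have [_ du] := su [::] (leq0n _) p Vp.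
by have [_ dv] := sv [::] (leq0n _) p Vp; rewrite /= (deriveM (du b) (dv b)).
Qed.

(** By the Leibniz rule a partial derivative of the product is a combination of products of
    functions of order [k], to which the induction hypothesis, general in both factors, applies. *)
Lemma smooth_upto_mul k V u v : open V ->
  smooth_upto k V u -> smooth_upto k V v -> smooth_upto k V (fun q => u q * v q).
Proof.
move=> oV; elim: k u v => [|k IH] u v su sv.
  case=> [|//] _ p Vp; have [cu du] := su [::] (leq0n _) p Vp.
  have [cv dv] := sv [::] (leq0n _) p Vp.
  by split=> [|b]; [exact: cvgM|exact: (derivableM (du b) (dv b))].
have su0 : smooth_upto 0 V u by exact: smooth_uptoW su.
have sv0 : smooth_upto 0 V v by exact: smooth_uptoW sv.
have suk : smooth_upto k V u by exact: smooth_uptoW su.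
have svk : smooth_upto k V v by exact: smooth_uptoW sv.
apply: smooth_uptoS => [|b].
  case=> [|//] _ p Vp; have [cu du] := su [::] (leq0n _) p Vp.
  have [cv dv] := sv [::] (leq0n _) p Vp.
  by split=> [|b]; [exact: cvgM|exact: (derivableM (du b) (dv b))].
have suvb := IH _ _ suk (smooth_upto_partial b sv).
have svub := IH _ _ svk (smooth_upto_partial b su).
refine (eq_smooth_upto oV _ (smooth_upto_lin 1 oV suvb svub)) => p Vp.
by rewrite (partialM b su0 sv0 Vp) mul1r.
Qed.

Lemma smooth_upto_cst k V (c : R) : smooth_upto k V (cst c).
Proof.
have cst_ w : exists c', iter_partial w (cst c) = cst c'.
  elim: w => [|b w [c' IH]]; first by exists c.
  exists 0; rewrite /iter_partial /= -/(iter_partial w _) IH.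
  by apply/funext => p; rewrite derive_cst.
move=> w _ p _; have [c' ->] := cst_ w.
by split=> [|b]; [exact: cvg_cst|exact: derivable_cst].
Qed.

End RealSmooth.

Section ComplexSmooth.
Context {R : realType}.
Implicit Types (V : set (R * R)) (f g : R * R -> R[i]) (w : seq bool) (c : R[i]).

Lemma eq_smooth_on V f g : open V -> (forall p, V p -> f p = g p) ->
  smooth_on V f -> smooth_on V g.
Proof.
move=> oV fg [/smooth_uptoP s1 /smooth_uptoP s2].
by split; apply/smooth_uptoP => k; [apply: eq_smooth_upto (s1 k)|
  apply: eq_smooth_upto (s2 k)] => // p Vp; rewrite fg.
Qed.

Lemma smooth_on_cst V c : smooth_on V (fun=> c).
Proof. by split; apply/smooth_uptoP => k; exact: smooth_upto_cst. Qed.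

Lemma smooth_onD V f g : open V ->
  smooth_on V f -> smooth_on V g -> smooth_on V (fun p => f p + g p).
Proof.
move=> oV [/smooth_uptoP f1 /smooth_uptoP f2] [/smooth_uptoP g1 /smooth_uptoP g2].
split; apply/smooth_uptoP => k.
  apply: eq_smooth_upto (smooth_upto_lin 1 oV (f1 k) (g1 k)) => // p _.
  by rewrite mul1r; case: (f p) (g p) => [? ?] [? ?].
apply: eq_smooth_upto (smooth_upto_lin 1 oV (f2 k) (g2 k)) => // p _.
by rewrite mul1r; case: (f p) (g p) => [? ?] [? ?].
Qed.

Lemma smooth_onM V f g : open V ->
  smooth_on V f -> smooth_on V g -> smooth_on V (fun p => f p * g p).
Proof.
move=> oV [/smooth_uptoP f1 /smooth_uptoP f2] [/smooth_uptoP g1 /smooth_uptoP g2].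
split; apply/smooth_uptoP => k.
  apply: eq_smooth_upto (smooth_upto_lin (-1) oV
    (smooth_upto_mul oV (f2 k) (g2 k)) (smooth_upto_mul oV (f1 k) (g1 k))) => // p _.
  by rewrite mulN1r addrC; case: (f p) (g p) => [? ?] [? ?].
apply: eq_smooth_upto (smooth_upto_lin 1 oV
    (smooth_upto_mul oV (f1 k) (g2 k)) (smooth_upto_mul oV (f2 k) (g1 k))) => // p _.
by rewrite mul1r; case: (f p) (g p) => [? ?] [? ?].
Qed.

Lemma smooth_onJ V f : open V -> smooth_on V f -> smooth_on V (fun p => Num.conj (f p)).
Proof.
move=> oV [f1 /smooth_uptoP f2]; split.
  suff -> : (fun p => complex.Re (Num.conj (f p))) = (fun p => complex.Re (f p)) by [].
  by apply/funext => p; case: (f p).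
apply/smooth_uptoP => k.
refine (eq_smooth_upto oV _ (smooth_upto_lin (-1) oV (f2 k) (@smooth_upto_cst _ k V 0))) => p _.
by rewrite mulN1r addr0; case: (f p) => ? ?.
Qed.

Lemma smooth_on_sum V (I : Type) (r : seq I) (Q : pred I) (F : I -> R * R -> R[i]) :
  open V -> (forall a, Q a -> smooth_on V (F a)) ->
  smooth_on V (fun p => \sum_(a <- r | Q a) F a p).
Proof.
move=> oV sF; elim: r => [|a r IH].
  by apply: eq_smooth_on (smooth_on_cst V 0) => // p _; rewrite big_nil.
case Qa: (Q a); last by apply: eq_smooth_on IH => // p _; rewrite big_cons Qa.
apply: eq_smooth_on (smooth_onD oV (sF a Qa) IH) => // p _.
by rewrite big_cons Qa.
Qed.

Lemma smooth_on_prod V (I : Type) (r : seq I) (Q : pred I) (F : I -> R * R -> R[i]) :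
  open V -> (forall a, Q a -> smooth_on V (F a)) ->
  smooth_on V (fun p => \prod_(a <- r | Q a) F a p).
Proof.
move=> oV sF; elim: r => [|a r IH].
  by apply: eq_smooth_on (smooth_on_cst V 1) => // p _; rewrite big_nil.
case Qa: (Q a); last by apply: eq_smooth_on IH => // p _; rewrite big_cons Qa.
apply: eq_smooth_on (smooth_onM oV (sF a Qa) IH) => // p _.
by rewrite big_cons Qa.
Qed.

Lemma iter_partialC_lin V c f g w : open V -> smooth_on V f -> smooth_on V g ->
  forall p, V p -> iter_partialC w (fun q => c * f q + g q) p =
    c * iter_partialC w f p + iter_partialC w g p.
Proof.
move=> oV [/smooth_uptoP f1 /smooth_uptoP f2] [/smooth_uptoP g1 /smooth_uptoP g2] p Vp.
case: c => a b; rewrite /iter_partialC; congr (_ +i* _).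
  rewrite (@eq_iter_partial _ V _ (fun q => a * complex.Re (f q) +
    (- b * complex.Im (f q) + complex.Re (g q)))) //; last first.
    by move=> q _; rewrite addrA mulNr; case: (f q) (g q) => [? ?] [? ?].
  rewrite (@iter_partial_lin _ (size w) V)//; last exact: smooth_upto_lin.
  rewrite (@iter_partial_lin _ (size w) V)// addrA mulNr.
  by [].
rewrite (@eq_iter_partial _ V _ (fun q => a * complex.Im (f q) +
    (b * complex.Re (f q) + complex.Im (g q)))) //; last first.
  by move=> q _; rewrite addrA; case: (f q) (g q) => [? ?] [? ?].
rewrite (@iter_partial_lin _ (size w) V)//; last exact: smooth_upto_lin.
by rewrite (@iter_partial_lin _ (size w) V)// addrA.
Qed.

Lemma iter_partialC_cst0 w (p : R * R) : iter_partialC w (fun=> 0 : R[i]) p = 0.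
Proof.
have e : iter_partial w (cst 0 : R * R -> R) = cst 0; last first.
  by rewrite /iter_partialC -[fun _ => _]/(cst 0) e.
elim: w => [//|b w IH]; rewrite /iter_partial /= -/(iter_partial w _) IH.
by apply/funext => q; rewrite derive_cst.
Qed.

End ComplexSmooth.

(** * Chain rule and Wirtinger derivatives *)

Section ChainRule.
Context {R : realType}.

Lemma is_derive_line (u : R * R -> R) (r v : R * R) (t : R) :
  derivable u (t *: v + r) v ->
  is_derive t 1 (fun s => u (s *: v + r)) ('D_v u (t *: v + r)).
Proof.
move=> du.
have e : (fun h : R => h^-1 *: (((fun s => u (s *: v + r)) \o shift t) (h *: 1) -
    u (t *: v + r))) =
    (fun h : R => h^-1 *: ((u \o shift (t *: v + r)) (h *: v) - u (t *: v + r))).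
  by apply/funext => h /=; rewrite [h *: 1]mulr1 scalerDl addrA.
by apply: DeriveDef; rewrite /derivable /derive e.
Qed.

(** The mean value theorem measured against slope [L]. A small [e] yields differentiability of C^1
    functions; [L = e = 0] yields local constancy. *)
Lemma mean_value_le (g dg : R -> R) (L e s : R) :
  (forall t : R, `|t| <= `|s| -> is_derive t 1 g (dg t) /\ `|dg t - L| <= e) ->
  `|g s - g 0 - L * s| <= e * `|s|.
Proof.
move=> H.
have seg a b : a <= b -> (forall t, a <= t <= b -> `|t| <= `|s|) ->
    `|g b - g a - L * (b - a)| <= e * (b - a).
  move=> ab sub.
  have dgab t : t \in `[a, b] -> is_derive t 1 g (dg t).
    by rewrite in_itv /= => /sub /H [].
  have dgoo t : t \in `]a, b[ -> is_derive t 1 g (dg t).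
    by move=> tab; apply: dgab; apply: subset_itv_oo_cc.
  have cg : {within `[a, b], continuous g}.
    by apply: derivable_within_continuous => t /dgab [].
  have [c cab gab] := MVT_segment ab dgoo cg; rewrite gab.
  rewrite -mulrBl normrM [X in _ * X]ger0_norm ?subr_ge0// ler_wpM2r ?subr_ge0//.
  by have [] := H c _ => //; apply: sub; rewrite in_itv in cab.
have [s0|s0] := leP 0 s.
  rewrite [X in e * X](ger0_norm s0); have := seg 0 s s0; rewrite subr0; apply=> t /andP[t0 ts].
  by rewrite !ger0_norm.
rewrite (ltr0_norm s0); have := seg s 0 (ltW s0); rewrite sub0r => H0.
rewrite -normrN -(_ : g 0 - g s - L * - s = - (g s - g 0 - L * s)).
  apply: H0 => t /andP[st t0].
  by rewrite (ltr0_norm s0) (ler0_norm t0) lerN2.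
by rewrite mulrN opprB opprK !opprD opprK; ring.
Qed.

(** The differential is bounded along a two-leg path parallel to the axes, each leg contributing
    half of the error. *)
Lemma differentiable_C1 (u : R * R -> R) (q : R * R) :
  (\forall r \near q, forall b, derivable u r (axis b)) ->
  (forall b, {for q, continuous (fun r => 'D_(axis b) u r)}) ->
  differentiable u q /\
  forall h, 'd u q h = h.1 * 'D_(axis false) u q + h.2 * 'D_(axis true) u q.
Proof.
move=> du cu.
pose d (h : R * R) : R := h.1 * 'D_(axis false) u q + h.2 * 'D_(axis true) u q.
have lin_d : linear d.
  by move=> k [x1 x2] [y1 y2]; rewrite /d /= !mulrDl addrACA -!mulrA scalerDr.
pose dM := GRing.isLinear.Build _ _ _ _ _ lin_d.
pose dL : {linear _ -> _} := HB.pack d dM.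
have cd : continuous dL.
  by move=> x; apply: cvgD; apply: cvgM; [exact: cvg_fst|exact: cvg_cst|exact: cvg_snd|exact: cvg_cst].
have dE (e : R) : 0 < e -> \forall h \near (0 : R * R),
    `|u (h + q) - (u q + d h)| <= e * `|h|.
  move=> e0.
  have e20 : 0 < e / 2 by rewrite divr_gt0.
  have [r1 /= r10 B1] := (@nbhs_ballP _ _ _ _).1 du.
  have near_b b : exists2 r : R, 0 < r & forall y, `|y| < r ->
      `|'D_(axis b) u (y + q) - 'D_(axis b) u q| <= e / 2.
    have /cvgrPdist_le/(_ _ e20) := cu b.
    move=> /nbhs_ballP [r /= r0 B]; exists r => // y yr.
    rewrite distrC; apply: B; rewrite -ball_normE /= opprD addrCA subrr addr0 normrN.
    exact: yr.
  have [r2 r20 B2] := near_b false; have [r3 r30 B3] := near_b true.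
  pose r := Num.min r1 (Num.min r2 r3).
  have r0 : 0 < r by rewrite !lt_min r10 r20 r30.
  have dB y b : `|y| < r -> derivable u (y + q) (axis b).
    rewrite lt_min => /andP[yr _]; apply: B1.
    by rewrite -ball_normE /= opprD addrCA subrr addr0 normrN.
  apply/nbhs_ballP; exists r => // h.
  rewrite -ball_normE /= sub0r normrN => hr.
  have n1 : `|h.1| <= `|h| by rewrite /Num.norm /= le_max lexx.
  have n2 : `|h.2| <= `|h| by rewrite /Num.norm /= le_max lexx orbT.
  (* The norm on the plane is the maximum norm, so both legs of the path stay inside the ball. *)
  have npair (a b : R) : `|a| <= `|h| -> `|b| <= `|h| -> `|(a, b) : R * R| < r.
    by move=> ah bh; apply: le_lt_trans hr; rewrite {1}/Num.norm /= ge_max ah bh.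
  (* The path goes vertically from [q] to [p2], then horizontally to [h + q]. *)
  pose p2 := h.2 *: axis true + q.
  have E1 (t : R) : t *: axis false + p2 = (t, h.2) + q.
    by rewrite /p2 /axis addrA; congr (_ + q); congr pair; rewrite /= /GRing.scale /=; ring.
  have E2 (t : R) : t *: axis true + q = (0, t) + q.
    by rewrite /axis; congr (_ + q); congr pair; rewrite /= /GRing.scale /=; ring.
  have S1 : `|u (h.1 *: axis false + p2) - u (0 *: axis false + p2) -
      'D_(axis false) u q * h.1| <= e / 2 * `|h.1|.
    apply: (mean_value_le (g := fun s => u (s *: axis false + p2))
      (dg := fun s => 'D_(axis false) u (s *: axis false + p2))) => t th.
    have tr : `|(t, h.2) : R * R| < r by apply: npair => //; exact: le_trans n1.
    split; first by apply: is_derive_line; rewrite E1; exact: dB.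
    by rewrite E1; apply: B2; apply: lt_le_trans tr _; rewrite !ge_min lexx orbT.
  have S2 : `|u (h.2 *: axis true + q) - u (0 *: axis true + q) -
      'D_(axis true) u q * h.2| <= e / 2 * `|h.2|.
    apply: (mean_value_le (g := fun s => u (s *: axis true + q))
      (dg := fun s => 'D_(axis true) u (s *: axis true + q))) => t th.
    have tr : `|(0, t) : R * R| < r.
      by apply: npair => //; [rewrite normr0|exact: le_trans n2].
    split; first by apply: is_derive_line; rewrite E2; exact: dB.
    by rewrite E2; apply: B3; apply: lt_le_trans tr _; rewrite !ge_min lexx !orbT.
  have -> : u (h + q) - (u q + d h) =
    (u (h.1 *: axis false + p2) - u (0 *: axis false + p2) - 'D_(axis false) u q * h.1) +
    (u (h.2 *: axis true + q) - u (0 *: axis true + q) - 'D_(axis true) u q * h.2).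
    rewrite E1 -surjective_pairing !scale0r !add0r -/p2.
    by rewrite /d; ring.
  apply: le_trans (ler_normD _ _) _; apply: le_trans (lerD S1 S2) _.
  rewrite [X in _ <= X * _]splitr mulrDl lerD// ler_wpM2l// ltW//.
have dd : 'd u q = dL :> (R * R -> R).
  by apply: diff_unique cd _; apply/eqaddoP => e e0; exact: dE.
split=> [|h]; last by rewrite dd.
by apply/diff_locallyP; rewrite dd; split=> //; apply/eqaddoP => e e0; exact: dE.
Qed.

(** Restricting to the line through [p] in direction [v] turns this into the chain rule for a curve
    followed by the differentiable function [u]. *)
Lemma derive_comp_C1 (u : R * R -> R) (a b : R * R -> R) (p v : R * R) :
  let q := (a p, b p) in
  (\forall r \near q, forall c, derivable u r (axis c)) ->
  (forall c, {for q, continuous (fun r => 'D_(axis c) u r)}) ->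
  derivable a p v -> derivable b p v ->
  'D_v (fun y => u (a y, b y)) p =
  'D_v a p * 'D_(axis false) u q + 'D_v b p * 'D_(axis true) u q.
Proof.
move=> q du cu da db; have [Du Eu] := differentiable_C1 du cu.
pose sa (t : R) := a (t *: v + p); pose sb (t : R) := b (t *: v + p).
have p0 : 0 *: v + p = p by rewrite scale0r add0r.
have ida : is_derive (0 : R) 1 sa ('D_v a p).
  by rewrite -[X in 'D_v a X]p0; apply: is_derive_line; rewrite p0.
have idb : is_derive (0 : R) 1 sb ('D_v b p).
  by rewrite -[X in 'D_v b X]p0; apply: is_derive_line; rewrite p0.
have dsa : differentiable sa 0 by apply/derivable1_diffP; case: ida.
have dsb : differentiable sb 0 by apply/derivable1_diffP; case: idb.
have q0 : (sa 0, sb 0) = q by rewrite /sa /sb p0.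
have Du0 : differentiable u (sa 0, sb 0) by rewrite q0.
have dpr := differentiable_pair dsa dsb.
have dcmp : differentiable (u \o (fun t => (sa t, sb t))) 0.
  exact: differentiable_comp dpr Du0.
have -> : 'D_v (fun y => u (a y, b y)) p = 'D_1 (u \o (fun t => (sa t, sb t))) 0.
  have e : (fun h : R => h^-1 *: (((fun y => u (a y, b y)) \o shift p) (h *: v) -
        u (a p, b p))) =
      (fun h : R => h^-1 *: (((u \o (fun t => (sa t, sb t))) \o shift 0) (h *: 1) -
        u (sa 0, sb 0))).
    by apply/funext => h /=; rewrite q0 addr0 [h *: 1]mulr1.
  by rewrite /derive e.
rewrite (deriveE _ dcmp) (diff_comp dpr Du0) /= (diff_pair dsa dsb) q0 Eu /=.
rewrite -(deriveE _ dsa) -(deriveE _ dsb).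
by rewrite (@derive_val _ _ _ _ _ _ _ ida) (@derive_val _ _ _ _ _ _ _ idb).
Qed.

End ChainRule.

Section ComplexDerivation.
Context {R : realType}.
Implicit Types (f g : R * R -> R[i]) (p : R * R) (e c : R[i]).

Definition derivableC f p : Prop := forall b,
  derivable (fun q => complex.Re (f q)) p (axis b) /\
  derivable (fun q => complex.Im (f q)) p (axis b).

(* [e = - 'i] gives d/dz and [e = 'i] gives d/dzbar. *)
Definition dw e f p : R[i] :=
  (iter_partialC [:: false] f p + e * iter_partialC [:: true] f p) / 2.

Lemma wirtingerE f p : wirtinger f p = dw (- 'i) f p.
Proof. by rewrite /wirtinger /dw mulNr. Qed.

Lemma smooth_on_derivableC (V : set (R * R)) f p :
  smooth_on V f -> V p -> derivableC f p.
Proof.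
move=> [f1 f2] Vp b; have [_ d1] := f1 [::] p Vp; have [_ d2] := f2 [::] p Vp.
by split; [exact: d1|exact: d2].
Qed.

Lemma near_dw e f g p : (\forall q \near p, f q = g q) -> dw e f p = dw e g p.
Proof.
move=> fg.
have E b : iter_partialC [:: b] f p = iter_partialC [:: b] g p.
  by congr (_ +i* _); apply: near_eq_derive; near=> q;
    [congr complex.Re|congr complex.Im]; near: q.
by rewrite /dw !E.
Unshelve. all: by end_near. Qed.

Let derR (u v : R * R -> R) p b (a : R) :
  derivable u p (axis b) -> derivable v p (axis b) ->
  derivable (fun q => a * u q + v q) p (axis b) /\
  'D_(axis b) (fun q => a * u q + v q) p = a * 'D_(axis b) u p + 'D_(axis b) v p.
Proof.
move=> du dv.
have dau : derivable (a *: u) p (axis b) by exact: derivableZ.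
by split; [exact: (derivableD dau dv)|rewrite (deriveD dau dv) (deriveZ _ du)].
Qed.

Let derRM (u v : R * R -> R) p b :
  derivable u p (axis b) -> derivable v p (axis b) ->
  derivable (fun q => u q * v q) p (axis b) /\
  'D_(axis b) (fun q => u q * v q) p =
    u p * 'D_(axis b) v p + v p * 'D_(axis b) u p.
Proof.
by move=> du dv; split; [exact: (derivableM du dv)|rewrite (deriveM du dv)].
Qed.

Let partialD f g p : derivableC f p -> derivableC g p ->
  derivableC (fun q => f q + g q) p /\
  forall b, iter_partialC [:: b] (fun q => f q + g q) p =
    iter_partialC [:: b] f p + iter_partialC [:: b] g p.
Proof.
move=> df dg.
have e1 : (fun q => complex.Re (f q + g q)) =
    (fun q => 1 * complex.Re (f q) + complex.Re (g q)).
  by apply/funext => q; rewrite mul1r; case: (f q) (g q) => [? ?] [? ?].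
have e2 : (fun q => complex.Im (f q + g q)) =
    (fun q => 1 * complex.Im (f q) + complex.Im (g q)).
  by apply/funext => q; rewrite mul1r; case: (f q) (g q) => [? ?] [? ?].
split=> b; have [f1 f2] := df b; have [g1 g2] := dg b;
  have [D1 E1] := derR 1 f1 g1; have [D2 E2] := derR 1 f2 g2.
  by split; [rewrite e1; exact: D1|rewrite e2; exact: D2].
by rewrite /iter_partialC e1 e2 /= E1 E2 !mul1r.
Qed.

Let partialM_ f g p : derivableC f p -> derivableC g p ->
  derivableC (fun q => f q * g q) p /\
  forall b, iter_partialC [:: b] (fun q => f q * g q) p =
    iter_partialC [:: b] f p * g p + f p * iter_partialC [:: b] g p.
Proof.
move=> df dg.
have e1 : (fun q => complex.Re (f q * g q)) =
    (fun q => -1 * (complex.Im (f q) * complex.Im (g q)) +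
              complex.Re (f q) * complex.Re (g q)).
  by apply/funext => q; rewrite mulN1r addrC; case: (f q) (g q) => [? ?] [? ?].
have e2 : (fun q => complex.Im (f q * g q)) =
    (fun q => 1 * (complex.Re (f q) * complex.Im (g q)) +
              complex.Im (f q) * complex.Re (g q)).
  by apply/funext => q; rewrite mul1r; case: (f q) (g q) => [? ?] [? ?].
split=> b; have [f1 f2] := df b; have [g1 g2] := dg b;
  have [D11 E11] := derRM f1 g1; have [D22 E22] := derRM f2 g2;
  have [D12 E12] := derRM f1 g2; have [D21 E21] := derRM f2 g1;
  have [D1 E1] := derR (-1) D22 D11; have [D2 E2] := derR 1 D12 D21.
  by split; [rewrite e1; exact: D1|rewrite e2; exact: D2].
rewrite /iter_partialC e1 e2 /= E1 E2 E11 E12 E21 E22.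
by case: (f p) (g p) => [? ?] [? ?] /=; congr (_ +i* _); ring.
Qed.

Let partialJ f p : derivableC f p ->
  derivableC (fun q => Num.conj (f q)) p /\
  forall b, iter_partialC [:: b] (fun q => Num.conj (f q)) p =
    Num.conj (iter_partialC [:: b] f p).
Proof.
move=> df.
have e1 : (fun q => complex.Re (Num.conj (f q))) = (fun q => complex.Re (f q)).
  by apply/funext => q; case: (f q).
have e2 : (fun q => complex.Im (Num.conj (f q))) = - (fun q => complex.Im (f q)).
  by apply/funext => q; rewrite /= /GRing.opp /=; case: (f q).
split=> b; have [f1 f2] := df b; have dN := derivableN f2.
  by split; [rewrite e1; exact: f1|rewrite e2; exact: dN].
by rewrite /iter_partialC e1 e2 /= (deriveN f2).
Qed.

Lemma derivableC_cst c p : derivableC (fun=> c) p.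
Proof. by move=> b; split; exact: derivable_cst. Qed.

Lemma derivableCD f g p : derivableC f p -> derivableC g p ->
  derivableC (fun q => f q + g q) p.
Proof. by move=> df dg; have [] := partialD df dg. Qed.

Lemma derivableCM f g p : derivableC f p -> derivableC g p ->
  derivableC (fun q => f q * g q) p.
Proof. by move=> df dg; have [] := partialM_ df dg. Qed.

Lemma derivableCJ f p : derivableC f p -> derivableC (fun q => Num.conj (f q)) p.
Proof. by move=> df; have [] := partialJ df. Qed.

Lemma dw_cst e c p : dw e (fun=> c) p = 0.
Proof.
have E b : iter_partialC [:: b] (fun=> c) p = 0.
  by rewrite /iter_partialC /= !derive_cst.
by rewrite /dw !E mulr0 addr0 mul0r.
Qed.

Lemma dwD e f g p : derivableC f p -> derivableC g p ->
  dw e (fun q => f q + g q) p = dw e f p + dw e g p.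
Proof.
by move=> df dg; have [_ E] := partialD df dg; rewrite /dw !E mulrDr addrACA mulrDl.
Qed.

Lemma dwM e f g p : derivableC f p -> derivableC g p ->
  dw e (fun q => f q * g q) p = dw e f p * g p + f p * dw e g p.
Proof.
move=> df dg; have [_ E] := partialM_ df dg; rewrite /dw !E.
rewrite mulrAC mulrA -mulrDl; congr (_ / 2).
by rewrite mulrDl !mulrDr addrACA !mulrA [f p * e]mulrC.
Qed.

Lemma dwJ e f p : derivableC f p ->
  dw e (fun q => Num.conj (f q)) p = Num.conj (dw (Num.conj e) f p).
Proof.
move=> df; have [_ E] := partialJ df.
by rewrite /dw !E fmorph_div rmorphD rmorphM rmorph_nat /= conjCK.
Qed.

(** Here [x] and [y] are the derivatives of a and b along the first axis; the Cauchy-Riemann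
    equations have already replaced those along the second axis by [- y] and [x]. *)
Let cauchy_riemann_alg (j F0 F1 x y : R[i]) : j * j = -1 ->
  (x * F0 + y * F1 - j * (- y * F0 + x * F1)) / 2 =
  (x + j * y - j * (- y + j * x)) / 2 * ((F0 - j * F1) / 2).
Proof. by move=> j2; field: j2. Qed.

(* For a holomorphic [a + i b] one has [d(a)/dz = (d(a + i b)/dz) / 2] and
   [d(b)/dz = - i (d(a + i b)/dz) / 2]. *)
Lemma wirtinger_comp (V : set (R * R)) f (a b : R * R -> R) p :
  open V -> smooth_on V f -> V (a p, b p) ->
  derivableC (fun y => cplx (a y, b y)) p ->
  wirtinger_bar (fun y => cplx (a y, b y)) p = 0 ->
  wirtinger (fun y => f (a y, b y)) p =
  wirtinger (fun y => cplx (a y, b y)) p * wirtinger f (a p, b p).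
Proof.
move=> oV [f1 f2] Vq dab; set q := (a p, b p).
have near_d (u : R * R -> R) : real_smooth_on V u ->
    (\forall r \near q, forall c : bool, derivable u r (axis c)) /\
    forall c : bool, {for q, continuous (fun r => 'D_(axis c) u r)}.
  move=> su; split=> [|b0]; last by have [] := su [:: b0] q Vq.
  near=> r => b0; have Vr : V r by near: r; exact: open_nbhs_nbhs.
  by have [_ /(_ b0)] := su [::] r Vr.
have [d1 c1] := near_d _ f1; have [d2 c2] := near_d _ f2.
have E (c : bool) : iter_partialC [:: c] (fun y => f (a y, b y)) p =
    ('D_(axis c) a p)%:C * iter_partialC [:: false] f q +
    ('D_(axis c) b p)%:C * iter_partialC [:: true] f q.
  have [da db] := dab c; rewrite /iter_partialC /=.
  rewrite (derive_comp_C1 d1 c1 da db) (derive_comp_C1 d2 c2 da db).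
  move: ('D_(axis c) a p) ('D_(axis c) b p) => x y.
  move: ('D_(axis false) _ q) ('D_(axis true) _ q) => z1 z2.
  move: ('D_(axis false) _ q) ('D_(axis true) _ q) => z3 z4.
  by congr (_ +i* _); ring.
have Eab (c : bool) : iter_partialC [:: c] (fun y => cplx (a y, b y)) p =
    ('D_(axis c) a p)%:C + 'i * ('D_(axis c) b p)%:C.
  by rewrite [LHS]complexE.
rewrite /wirtinger /wirtinger_bar !E !Eab.
move: (iter_partialC [:: false] f q) (iter_partialC [:: true] f q) => F0 F1.
move: ('D_(axis false) a p) ('D_(axis true) a p) => ax ay.
move: ('D_(axis false) b p) ('D_(axis true) b p) => bx by_.
move/eqP; rewrite mulf_eq0 invr_eq0 pnatr_eq0 orbF => /eqP H.
have h1 : ax = by_.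
  by move/(congr1 (@complex.Re R)): H => /=; lra.
have h2 : ay = - bx.
  by move/(congr1 (@complex.Im R)): H => /=; lra.
rewrite {}h2 -{}h1 {H} rmorphN.
by apply: cauchy_riemann_alg; rewrite -expr2 sqr_i.
Unshelve. all: by end_near. Qed.

End ComplexDerivation.

(** * Derivations on the surface *)

Section SurfaceDerivation.
Context {R : realType} {X : riemann_surface R}.
Implicit Types (i j : chart X) (x : X) (D : set X) (f g : X -> R[i]) (e c : R[i]).

(** Keeping [e] as a parameter lets each rule of calculus be proved once for d/dz and d/dzbar. *)
Definition der e i f x : R[i] := dw e (fun p => f (par i p)) (crd i x).

Definition diff_at i f x : Prop := derivableC (fun p => f (par i p)) (crd i x).

Lemma dzE i f x : dz i f x = der (- 'i) i f x.
Proof. exact: wirtingerE. Qed.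

Lemma near_chart D i x : open D -> D x -> dom i x ->
  \forall p \near crd i x, D (par i p).
Proof.
move=> oD Dx ix.
have cp : {for crd i x, continuous (par i)} by apply: rs_par_cont; exists x.
by apply: cp; rewrite (rs_crdK ix); exact: open_nbhs_nbhs.
Qed.

Lemma eq_der D e i f g x : open D -> D x -> dom i x ->
  (forall y, D y -> f y = g y) -> der e i f x = der e i g x.
Proof.
move=> oD Dx ix fg; apply: near_dw; near=> p; apply: fg; near: p.
exact: near_chart.
Unshelve. all: by end_near. Qed.

Lemma smooth_in_diff_at D i f x : smooth_in i D f -> D x -> diff_at i f x.
Proof. by move=> sf Dx; apply: smooth_on_derivableC sf _; exists x. Qed.

Lemma diff_at_cst i c x : diff_at i (fun=> c) x.
Proof. exact: derivableC_cst. Qed.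

Lemma diff_atD i f g x : diff_at i f x -> diff_at i g x ->
  diff_at i (fun y => f y + g y) x.
Proof. exact: derivableCD. Qed.

Lemma diff_atM i f g x : diff_at i f x -> diff_at i g x ->
  diff_at i (fun y => f y * g y) x.
Proof. exact: derivableCM. Qed.

Lemma diff_atJ i f x : diff_at i f x -> diff_at i (fun y => Num.conj (f y)) x.
Proof. exact: derivableCJ. Qed.

Lemma der_cst e i c x : der e i (fun=> c) x = 0.
Proof. exact: dw_cst. Qed.

Lemma derD e i f g x : diff_at i f x -> diff_at i g x ->
  der e i (fun y => f y + g y) x = der e i f x + der e i g x.
Proof. exact: dwD. Qed.

Lemma derM e i f g x : dom i x -> diff_at i f x -> diff_at i g x ->
  der e i (fun y => f y * g y) x = der e i f x * g x + f x * der e i g x.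
Proof. by move=> ix df dg; rewrite /der (dwM e df dg) (rs_crdK ix). Qed.

Lemma derJ e i f x : diff_at i f x ->
  der e i (fun y => Num.conj (f y)) x = Num.conj (der (Num.conj e) i f x).
Proof. exact: dwJ. Qed.

Opaque der diff_at.

Lemma diff_at_sum (I : Type) (r : seq I) (Q : pred I) (F : I -> X -> R[i]) i x :
  (forall a, Q a -> diff_at i (F a) x) ->
  diff_at i (fun y => \sum_(a <- r | Q a) F a y) x.
Proof.
move=> dF.
rewrite (_ : (fun y => _) = \sum_(a <- r | Q a) F a); last first.
  by apply/funext => y; rewrite fct_sumE.
by elim/big_ind : _ => [|f g df dg|//]; [exact: diff_at_cst|exact: diff_atD].
Qed.

Lemma der_sum (I : Type) (r : seq I) (F : I -> X -> R[i]) e i x :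
  (forall a, diff_at i (F a) x) ->
  der e i (fun y => \sum_(a <- r) F a y) x = \sum_(a <- r) der e i (F a) x.
Proof.
move=> dF; elim: r => [|a r IH].
  rewrite big_nil (_ : (fun y => _) = (fun=> 0)) ?der_cst//.
  by apply/funext => y; rewrite big_nil.
have dr : diff_at i (fun y => \sum_(b <- r) F b y) x by exact: diff_at_sum.
rewrite (_ : (fun y => _) = (fun y => F a y + \sum_(b <- r) F b y)); last first.
  by apply/funext => y; rewrite big_cons.
by rewrite big_cons -IH; exact: (derD e (dF a) dr).
Qed.

Lemma diff_at_prod (I : Type) (r : seq I) (F : I -> X -> R[i]) i x :
  (forall a, diff_at i (F a) x) ->
  diff_at i (fun y => \prod_(a <- r) F a y) x.
Proof.
move=> dF; elim: r => [|a r IH].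
  rewrite (_ : (fun y => _) = (fun=> 1)); first exact: diff_at_cst.
  by apply/funext => y; rewrite big_nil.
rewrite (_ : (fun y => _) = (fun y => F a y * \prod_(b <- r) F b y)).
  exact: (diff_atM (dF a) IH).
by apply/funext => y; rewrite big_cons.
Qed.

(** Each term is a full product with one factor replaced, so that [der_det] can read it off a matrix
    with one row replaced; [uniq r] ensures that only one position changes. *)
Lemma der_prod (I : eqType) (r : seq I) (F : I -> X -> R[i]) e i x :
  uniq r -> dom i x -> (forall a, diff_at i (F a) x) ->
  der e i (fun y => \prod_(a <- r) F a y) x =
  \sum_(a <- r) \prod_(b <- r) (if b == a then der e i (F a) x else F b x).
Proof.
move=> + ix dF; elim: r => [_|a r IH /= /andP[ar ur]].
  rewrite big_nil (_ : (fun y => _) = (fun=> 1)) ?der_cst//.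
  by apply/funext => y; rewrite big_nil.
rewrite (_ : (fun y => _) = (fun y => F a y * \prod_(b <- r) F b y)); last first.
  by apply/funext => y; rewrite big_cons.
have dr : diff_at i (fun y => \prod_(b <- r) F b y) x by exact: diff_at_prod.
rewrite (derM e ix (dF a) dr) (IH ur) !big_cons eqxx; congr (_ * _ + _).
  by apply: eq_big_seq => b br; case: eqP => // ba; rewrite -ba br in ar.
rewrite mulr_sumr; apply: eq_big_seq => b br; rewrite big_cons.
by case: eqP => // ab; rewrite ab br in ar.
Qed.

Transparent der diff_at.

(** Near the point, [f] read in the chart [i] is [f] read in the chart [j] composed with the
    holomorphic change of coordinates. *)
Lemma dz_chain i j f x : dom i x -> dom j x -> smooth_in j (dom j) f ->
  dz i f x = jac i j x * dz j f x.
Proof.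
move=> ix jx sf; rewrite /jac /dz.
have xK : par i (crd i x) = x by exact: rs_crdK.
have [st ht] := rs_holo i j.
have Vx : (crd i @` (dom i `&` dom j)) (crd i x) by exists x.
transitivity (wirtinger
    (fun p => f (par j ((crd j (par i p)).1, (crd j (par i p)).2))) (crd i x)).
  rewrite !wirtingerE; apply: near_dw; near=> p.
  rewrite -surjective_pairing rs_crdK//; near: p.
  by apply: near_chart => //; exact: rs_dom_open.
rewrite (@wirtinger_comp _ (crd j @` dom j) (fun p => f (par j p))
  (fun p => (crd j (par i p)).1) (fun p => (crd j (par i p)).2) (crd i x)).
- by rewrite -!surjective_pairing xK; congr (wirtinger _ _ * _); apply/funext => p;
    rewrite -surjective_pairing.
- exact: rs_img_open.
- exact: sf.
- by rewrite -surjective_pairing xK; exists x.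
- by apply: smooth_on_derivableC Vx; exact: st.
- exact: ht.
Unshelve. all: by end_near. Qed.

Opaque der diff_at.

End SurfaceDerivation.

(** * Matrix-valued functions: product rules, Jacobi's formula, smoothness *)

Section MatrixDerivation.
Context {R : realType} {X : riemann_surface R}.
Implicit Types (i j : chart X) (x : X) (D : set X) (e c : R[i]) (m n p : nat).

Definition der_mx m n e i (M : X -> 'M[R[i]]_(m, n)) x : 'M[R[i]]_(m, n) :=
  \matrix_(a, b) der e i (fun y => M y a b) x.

Definition diff_mx m n i (M : X -> 'M[R[i]]_(m, n)) x : Prop :=
  forall a b, diff_at i (fun y => M y a b) x.

Lemma dz_mxE m n i (M : X -> 'M[R[i]]_(m, n)) x : dz_mx i M x = der_mx (- 'i) i M x.
Proof. by apply/matrixP => a b; rewrite !mxE dzE. Qed.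

Lemma dzbar_mxE m n i (M : X -> 'M[R[i]]_(m, n)) x : dzbar_mx i M x = der_mx 'i i M x.
Proof. by apply/matrixP => a b; rewrite !mxE. Qed.

Lemma smooth_diff_mx m n D i (M : X -> 'M[R[i]]_(m, n)) x :
  smooth_mx i D M -> D x -> diff_mx i M x.
Proof. by move=> sM Dx a b; exact: smooth_in_diff_at (sM a b) Dx. Qed.

Lemma eq_der_mx m n D e i (M N : X -> 'M[R[i]]_(m, n)) x :
  open D -> D x -> dom i x -> (forall y, D y -> M y = N y) ->
  der_mx e i M x = der_mx e i N x.
Proof.
move=> oD Dx ix MN; apply/matrixP => a b; rewrite !mxE.
by apply: eq_der oD Dx ix _ => y /MN ->.
Qed.

Lemma diff_mxD m n i (M N : X -> 'M[R[i]]_(m, n)) x :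
  diff_mx i M x -> diff_mx i N x -> diff_mx i (fun y => M y + N y) x.
Proof.
move=> dM dN a b; rewrite (_ : (fun y => _) = (fun y => M y a b + N y a b)).
  exact: diff_atD.
by apply/funext => y; rewrite mxE.
Qed.

Lemma diff_mx_cst m n i (C : 'M[R[i]]_(m, n)) x : diff_mx i (fun=> C) x.
Proof. by move=> a b; exact: diff_at_cst. Qed.

Lemma diff_mxZ m n i c (M : X -> 'M[R[i]]_(m, n)) x :
  diff_mx i M x -> diff_mx i (fun y => c *: M y) x.
Proof.
move=> dM a b; rewrite (_ : (fun y => _) = (fun y => c * M y a b)).
  by apply: diff_atM => //; exact: diff_at_cst.
by apply/funext => y; rewrite mxE.
Qed.

Lemma diff_mxM m n p i (M : X -> 'M[R[i]]_(m, n)) (N : X -> 'M[R[i]]_(n, p)) x :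
  diff_mx i M x -> diff_mx i N x -> diff_mx i (fun y => M y *m N y) x.
Proof.
move=> dM dN a b; rewrite (_ : (fun y => _) = (fun y => \sum_k M y a k * N y k b)).
  by apply: diff_at_sum => k _; exact: diff_atM.
by apply/funext => y; rewrite mxE.
Qed.

Lemma diff_mxJ m n i (M : X -> 'M[R[i]]_(m, n)) x :
  diff_mx i M x -> diff_mx i (fun y => (M y)^t*) x.
Proof.
move=> dM a b; rewrite (_ : (fun y => _) = (fun y => Num.conj (M y b a))).
  exact: diff_atJ.
by apply/funext => y; rewrite !mxE.
Qed.

Lemma der_mx_cst m n e i (C : 'M[R[i]]_(m, n)) x : der_mx e i (fun=> C) x = 0.
Proof. by apply/matrixP => a b; rewrite !mxE der_cst. Qed.

Lemma der_mxD m n e i (M N : X -> 'M[R[i]]_(m, n)) x :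
  diff_mx i M x -> diff_mx i N x ->
  der_mx e i (fun y => M y + N y) x = der_mx e i M x + der_mx e i N x.
Proof.
move=> dM dN; apply/matrixP => a b; rewrite !mxE.
rewrite (_ : (fun y => _) = (fun y => M y a b + N y a b)); last first.
  by apply/funext => y; rewrite mxE.
exact: (derD e (dM a b) (dN a b)).
Qed.

Lemma der_mxZ m n e i c (M : X -> 'M[R[i]]_(m, n)) x : dom i x ->
  diff_mx i M x -> der_mx e i (fun y => c *: M y) x = c *: der_mx e i M x.
Proof.
move=> ix dM; apply/matrixP => a b; rewrite !mxE.
rewrite (_ : (fun y => _) = (fun y => c * M y a b)); last first.
  by apply/funext => y; rewrite mxE.
rewrite (derM e ix (diff_at_cst i c x) (dM a b)).
by rewrite der_cst mul0r add0r.
Qed.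

Lemma der_mxM m n p e i (M : X -> 'M[R[i]]_(m, n)) (N : X -> 'M[R[i]]_(n, p)) x :
  dom i x -> diff_mx i M x -> diff_mx i N x ->
  der_mx e i (fun y => M y *m N y) x = der_mx e i M x *m N x + M x *m der_mx e i N x.
Proof.
move=> ix dM dN; apply/matrixP => a b; rewrite !mxE.
rewrite (_ : (fun y => _) = (fun y => \sum_k M y a k * N y k b)); last first.
  by apply/funext => y; rewrite mxE.
rewrite der_sum => [|k]; last exact: diff_atM.
rewrite -big_split; apply: eq_bigr => k _; rewrite !mxE.
exact: (derM e ix (dM a k) (dN k b)).
Qed.

Lemma der_mxJ m n e i (M : X -> 'M[R[i]]_(m, n)) x : diff_mx i M x ->
  der_mx e i (fun y => (M y)^t*) x = (der_mx (Num.conj e) i M x)^t*.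
Proof.
move=> dM; apply/matrixP => a b; rewrite !mxE.
rewrite (_ : (fun y => _) = (fun y => Num.conj (M y b a))); last first.
  by apply/funext => y; rewrite !mxE.
exact: (derJ e (dM b a)).
Qed.

Lemma dzJ m n i (M : X -> 'M[R[i]]_(m, n)) x : diff_mx i M x ->
  dz_mx i (fun y => (M y)^t*) x = (dzbar_mx i M x)^t*.
Proof.
move=> dM; rewrite dz_mxE dzbar_mxE der_mxJ// (_ : Num.conj (- 'i) = 'i)//.
by apply/eqP; rewrite eq_complex /= opprK oppr0 !eqxx.
Qed.

Lemma der_mx_sum m n (I : Type) (r : seq I) (F : I -> X -> 'M[R[i]]_(m, n)) e i x :
  (forall a, diff_mx i (F a) x) ->
  diff_mx i (fun y => \sum_(a <- r) F a y) x /\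
  der_mx e i (fun y => \sum_(a <- r) F a y) x = \sum_(a <- r) der_mx e i (F a) x.
Proof.
move=> dF; elim: r => [|a r [IHd IH]].
  rewrite (_ : (fun y => _) = (fun=> 0)).
    by split; [exact: diff_mx_cst|rewrite big_nil der_mx_cst].
  by apply/funext => y; rewrite big_nil.
rewrite (_ : (fun y => _) = (fun y => F a y + \sum_(b <- r) F b y)).
  by split; [exact: (diff_mxD (dF a) IHd)|rewrite (der_mxD e (dF a) IHd) big_cons IH].
by apply/funext => y; rewrite big_cons.
Qed.

(* Jacobi's formula: differentiate the rows one at a time and expand along the
   differentiated row. *)
Lemma der_det n e i (M : X -> 'M[R[i]]_n) x : dom i x -> diff_mx i M x ->
  der e i (fun y => \det (M y)) x = \tr (\adj (M x) *m der_mx e i M x).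
Proof.
move=> ix dM; rewrite /determinant der_sum; last first.
  by move=> s; apply: diff_atM; [exact: diff_at_cst|exact: diff_at_prod].
pose N k : 'M[R[i]]_n := \matrix_(a, b) if a == k then der_mx e i M x k b else M x a b.
transitivity (\sum_k \det (N k)).
  rewrite exchange_big; apply: eq_bigr => s _.
  have dp : diff_at i (fun y => \prod_k M y k (s k)) x by exact: diff_at_prod.
  rewrite (derM e ix (diff_at_cst i _ x) dp) der_cst mul0r add0r.
  rewrite (der_prod e (index_enum_uniq _) ix) => [|k]; last exact: dM.
  rewrite mulr_sumr.
  apply: eq_bigr => k _; congr (_ * _); apply: eq_bigr => a _.
  by rewrite mxE; case: eqP => [->|//]; rewrite mxE.
transitivity (\sum_k \sum_b cofactor (M x) k b * der_mx e i M x k b).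
  apply: eq_bigr => k _.
  rewrite (expand_det_row _ k); apply: eq_bigr => b _.
  rewrite [N k k b]mxE eqxx mulrC; congr (_ * _); rewrite /cofactor.
  (* Deleting row [k] removes the only row in which [N k] differs from [M x]. *)
  congr (_ * \det _); apply/matrixP => a d.
  by rewrite !mxE eq_sym (negbTE (neq_lift _ _)).
rewrite exchange_big; apply: eq_bigr => b _; rewrite mxE.
by apply: eq_bigr => k _; rewrite [\adj _ b k]mxE.
Qed.

Lemma eq_smooth_mx m n i (M N : X -> 'M[R[i]]_(m, n)) :
  (forall x, dom i x -> M x = N x) -> smooth_mx i (dom i) M -> smooth_mx i (dom i) N.
Proof.
move=> MN sM a b; apply: eq_smooth_on (sM a b); first exact: rs_img_open.
by move=> _ [x ix <-]; rewrite rs_crdK// MN.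
Qed.

Lemma smooth_mx_cst m n i (C : 'M[R[i]]_(m, n)) : smooth_mx i (dom i) (fun=> C).
Proof. by move=> a b; exact: smooth_on_cst. Qed.

Lemma smooth_mxD m n i (M N : X -> 'M[R[i]]_(m, n)) :
  smooth_mx i (dom i) M -> smooth_mx i (dom i) N ->
  smooth_mx i (dom i) (fun x => M x + N x).
Proof.
move=> sM sN a b; rewrite /smooth_in.
rewrite (_ : (fun q => _) = (fun q => M (par i q) a b + N (par i q) a b)).
  by apply: smooth_onD; [exact: rs_img_open|exact: sM|exact: sN].
by apply/funext => q; rewrite mxE.
Qed.

Lemma smooth_mxM m n p i (M : X -> 'M[R[i]]_(m, n)) (N : X -> 'M[R[i]]_(n, p)) :
  smooth_mx i (dom i) M -> smooth_mx i (dom i) N ->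
  smooth_mx i (dom i) (fun x => M x *m N x).
Proof.
move=> sM sN a b; rewrite /smooth_in.
rewrite (_ : (fun q => _) = (fun q => \sum_k M (par i q) a k * N (par i q) k b)).
  apply: smooth_on_sum => [|k _]; first exact: rs_img_open.
  by apply: smooth_onM; [exact: rs_img_open|exact: sM|exact: sN].
by apply/funext => q; rewrite mxE.
Qed.

Lemma smooth_mxZ m n i c (M : X -> 'M[R[i]]_(m, n)) :
  smooth_mx i (dom i) M -> smooth_mx i (dom i) (fun x => c *: M x).
Proof.
move=> sM; apply: (@eq_smooth_mx _ _ _ (fun x => c%:M *m M x)).
  by move=> x _; rewrite mul_scalar_mx.
by apply: smooth_mxM => //; exact: smooth_mx_cst.
Qed.

Lemma smooth_mxJ m n i (M : X -> 'M[R[i]]_(m, n)) :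
  smooth_mx i (dom i) M -> smooth_mx i (dom i) (fun x => (M x)^t*).
Proof.
move=> sM a b; rewrite /smooth_in.
rewrite (_ : (fun q => _) = (fun q => Num.conj (M (par i q) b a))).
  by apply: smooth_onJ; [exact: rs_img_open|exact: sM].
by apply/funext => q; rewrite !mxE.
Qed.

Lemma smooth_mx_sum m n (I : Type) (r : seq I) (Q : pred I)
    (F : I -> X -> 'M[R[i]]_(m, n)) i :
  (forall a, Q a -> smooth_mx i (dom i) (F a)) ->
  smooth_mx i (dom i) (fun x => \sum_(a <- r | Q a) F a x).
Proof.
move=> sF; rewrite (_ : (fun x => _) = \sum_(a <- r | Q a) F a); last first.
  by apply/funext => y; rewrite fct_sumE.
by elim/big_ind : _ => [|f g df dg|//]; [exact: smooth_mx_cst|exact: smooth_mxD].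
Qed.

(** Cofactors are polynomials in the entries. For matrices of determinant 1 the adjugate is the
    inverse, which is thereby smooth. *)
Lemma smooth_mx_adj n i (M : X -> 'M[R[i]]_n) :
  smooth_mx i (dom i) M -> smooth_mx i (dom i) (fun x => \adj (M x)).
Proof.
move=> sM a b; have oV : open (crd i @` dom i) by exact: rs_img_open.
 rewrite /smooth_in.
rewrite (_ : (fun q => _) = (fun q => (-1) ^+ (b + a) * \sum_(s : 'S_n.-1) (-1) ^+ s *
    \prod_k M (par i q) (lift b k) (lift a (s k)))).
  apply: smooth_onM => //; first exact: smooth_on_cst.
  apply: smooth_on_sum => // s _; apply: smooth_onM => //; first exact: smooth_on_cst.
  by apply: smooth_on_prod => // k _; exact: sM.
apply/funext => q; rewrite mxE /cofactor; congr (_ * _).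
by apply: eq_bigr => s _; congr (_ * _); apply: eq_bigr => k _; rewrite !mxE.
Qed.

End MatrixDerivation.

(** * Hermitian metrics and Chern connections *)

Section SmoothDerivatives.
Context {R : realType} {X : riemann_surface R}.

Lemma smooth_on_partial (V : set (R * R)) (f : R * R -> R[i]) (b : bool) :
  smooth_on V f -> smooth_on V (iter_partialC [:: b] f).
Proof.
move=> [f1 f2]; split=> w p Vp.
  by have := f1 (rcons w b) p Vp; rewrite iter_partial_rcons.
by have := f2 (rcons w b) p Vp; rewrite iter_partial_rcons.
Qed.

Lemma smooth_on_dw (V : set (R * R)) (f : R * R -> R[i]) (e : R[i]) :
  open V -> smooth_on V f -> smooth_on V (dw e f).
Proof.
move=> oV sf; apply: (smooth_onM oV _ (smooth_on_cst _ _)).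
apply: (smooth_onD oV); first exact: smooth_on_partial.
by apply: (smooth_onM oV (smooth_on_cst _ _)); exact: smooth_on_partial.
Qed.

Transparent der.

Lemma smooth_mx_der m n i e (M : X -> 'M[R[i]]_(m, n)) :
  smooth_mx i (dom i) M -> smooth_mx i (dom i) (der_mx e i M).
Proof.
move=> sM a b.
have oV : open (crd i @` dom i) by exact: rs_img_open.
apply: (eq_smooth_on oV _ (smooth_on_dw e oV (sM a b))) => _ [x ix <-].
by rewrite rs_crdK// mxE.
Qed.

Opaque der.

End SmoothDerivatives.

Section ConjTranspose.
Context {C : numClosedFieldType}.

Lemma ctrM m n p (M : 'M[C]_(m, n)) (N : 'M[C]_(n, p)) :
  (M *m N)^t* = N^t* *m M^t*.
Proof. by rewrite trmx_mul map_mxM. Qed.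

Lemma ctrD m n (M N : 'M[C]_(m, n)) : (M + N)^t* = M^t* + N^t*.
Proof. by apply/matrixP => a b; rewrite !mxE rmorphD. Qed.

Lemma ctrB m n (M N : 'M[C]_(m, n)) : (M - N)^t* = M^t* - N^t*.
Proof. by apply/matrixP => a b; rewrite !mxE rmorphB. Qed.

Lemma ctrZ m n c (M : 'M[C]_(m, n)) : (c *: M)^t* = Num.conj c *: M^t*.
Proof. by apply/matrixP => a b; rewrite !mxE rmorphM. Qed.

Lemma ctrK m n (M : 'M[C]_(m, n)) : (M^t*)^t* = M.
Proof. by apply/matrixP => a b; rewrite !mxE conjCK. Qed.

Lemma ctr0 m n : (0 : 'M[C]_(m, n))^t* = 0.
Proof. by apply/matrixP => a b; rewrite !mxE rmorph0. Qed.

Lemma mxtrace_ctr n (M : 'M[C]_n) : \tr (M^t*) = Num.conj (\tr M).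
Proof. by rewrite /mxtrace rmorph_sum; apply: eq_bigr => a _; rewrite !mxE. Qed.

End ConjTranspose.

Section MatrixEntries.
Context {K : pzRingType} {m n : nat}.

Lemma addmx_entry (A B : 'M[K]_(m, n)) a b : (A + B) a b = A a b + B a b.
Proof. by rewrite mxE. Qed.

Lemma oppmx_entry (A : 'M[K]_(m, n)) a b : (- A) a b = - A a b.
Proof. by rewrite mxE. Qed.

Lemma scalemx_entry c (A : 'M[K]_(m, n)) a b : (c *: A) a b = c * A a b.
Proof. by rewrite mxE. Qed.

Lemma zeromx_entry a b : (0 : 'M[K]_(m, n)) a b = 0.
Proof. by rewrite mxE. Qed.

End MatrixEntries.

(* Linear identities between matrices, the products being treated as atoms. *)
Ltac mx_linear :=
  repeat match goal with |- context [?A *m ?B] => move: (A *m B) => ? end;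
  apply/matrixP => ? ?;
  rewrite ?(addmx_entry, oppmx_entry, scalemx_entry, zeromx_entry); ring.

Section HermitianMetric.
Context {R : realType} {X : riemann_surface R} {n : nat} (E : su_bundle X n).
Implicit Types (i j : chart X) (x : X) (A s h : coefs X n).

Lemma metric_unit h i x : is_metric E h -> dom i x -> h i x \in unitmx.
Proof. by move=> [_ hh _] ix; have [_ d _] := hh i x ix; rewrite unitmxE d unitr1. Qed.

Lemma metric_inv h i x : is_metric E h -> dom i x -> invmx (h i x) = \adj (h i x).
Proof.
move=> mh ix; rewrite /invmx (metric_unit mh ix).
by have [_ /(_ i x ix)[_ -> _] _] := mh; rewrite invr1 scale1r.
Qed.

Lemma metric_diff h i x : is_metric E h -> dom i x -> diff_mx i (h i) x.
Proof. by move=> [sh _ _] ix; exact: smooth_diff_mx (sh i) ix. Qed.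

(** Multiplying by [h] on the left clears the inverse in [adj_h], which therefore never has to be
    differentiated. *)
Lemma mul_adj_h h s i x : is_metric E h -> dom i x ->
  h i x *m adj_h h s i x = (s i x)^t* *m h i x.
Proof.
by move=> mh ix; rewrite /adj_h !mulmxA mulmxV ?mul1mx// (metric_unit mh ix).
Qed.

Lemma adj_h_eq h s i x M : is_metric E h -> dom i x ->
  h i x *m M = (s i x)^t* *m h i x -> adj_h h s i x = M.
Proof.
move=> mh ix e; have u := metric_unit mh ix.
by rewrite -[RHS](mulKmx u) e -(mul_adj_h s mh ix) (mulKmx u).
Qed.

Lemma adj_h_eq0 h s i x : s i x = 0 -> adj_h h s i x = 0.
Proof. by move=> s0; rewrite /adj_h s0 ctr0 mulmx0 mul0mx. Qed.

Lemma mxtrace_adj_h h s i x : is_metric E h -> dom i x -> \tr (s i x) = 0 ->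
  \tr (adj_h h s i x) = 0.
Proof.
move=> mh ix s0; rewrite /adj_h mxtrace_mulC mulmxA (mulmxV (metric_unit mh ix)).
by rewrite mul1mx mxtrace_ctr s0 rmorph0.
Qed.

Lemma smooth_metric_inv h i : is_metric E h ->
  smooth_mx i (dom i) (fun x => invmx (h i x)).
Proof.
move=> mh; have [sh _ _] := mh.
apply: (eq_smooth_mx _ (smooth_mx_adj (sh i))) => x ix.
by rewrite (metric_inv mh ix).
Qed.

Lemma smooth_adj_h h s : is_metric E h -> smooth_coefs s -> smooth_coefs (adj_h h s).
Proof.
move=> mh ss i; have [sh _ _] := mh.
apply: smooth_mxM (sh i); apply: smooth_mxM; first exact: smooth_metric_inv.
exact: smooth_mxJ.
Qed.

Lemma smooth_chern10 h A : is_metric E h -> smooth_coefs A -> smooth_coefs (chern10 A h).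
Proof.
move=> mh sA i; have [sh _ _] := mh.
apply: smooth_mxM; first exact: smooth_metric_inv.
apply: (@eq_smooth_mx _ _ _ _ _ (fun x =>
    der_mx (- 'i) i (h i) x + (- 1) *: ((A i x)^t* *m h i x))).
  by move=> x ix; rewrite dz_mxE scaleN1r.
apply: smooth_mxD; first exact: smooth_mx_der.
by apply: smooth_mxZ; apply: smooth_mxM (sh i); exact: smooth_mxJ.
Qed.

Lemma mul_chern10 h A i x : is_metric E h -> dom i x ->
  h i x *m chern10 A h i x = dz_mx i (h i) x - (A i x)^t* *m h i x.
Proof. by move=> mh ix; rewrite /chern10 mulmxA mulmxV ?mul1mx// (metric_unit mh ix). Qed.

(** The Chern connection is compatible with adjoints: differentiating [h s^* = s^t* h] produces
    derivatives of [h] that cancel against those in [chern10]. It turns dbar-holomorphic objects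
    into del^h-parallel adjoints. *)
Lemma end10_adj_h h A s i x : is_metric E h -> smooth_coefs s -> dom i x ->
  end10 1 (chern10 A h) (adj_h h s) i x = adj_h h (end01 A s) i x.
Proof.
move=> mh ss ix; have u := metric_unit mh ix.
have dh := metric_diff mh ix.
have ds : diff_mx i (s i) x by exact: smooth_diff_mx (ss i) ix.
have da : diff_mx i (adj_h h s i) x.
  exact: smooth_diff_mx (smooth_adj_h mh ss i) ix.
have dha : dz_mx i (h i) x *m adj_h h s i x + h i x *m dz_mx i (adj_h h s i) x =
    (dzbar_mx i (s i) x)^t* *m h i x + (s i x)^t* *m dz_mx i (h i) x.
  rewrite -(dzJ ds) !dz_mxE -(der_mxM _ ix dh da) -(der_mxM _ ix (diff_mxJ ds) dh).
  apply: (eq_der_mx _ (@rs_dom_open _ X i) ix ix) => y iy.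
  exact: mul_adj_h.
apply/esym; apply: (adj_h_eq mh ix).
have e1 : h i x *m (chern10 A h i x *m adj_h h s i x) =
    dz_mx i (h i) x *m adj_h h s i x - (A i x)^t* *m ((s i x)^t* *m h i x).
  rewrite mulmxA (mul_chern10 A mh ix) mulmxBl -[(A i x)^t* *m h i x *m _]mulmxA.
  by rewrite (mul_adj_h s mh ix).
have e2 : h i x *m (adj_h h s i x *m chern10 A h i x) =
    (s i x)^t* *m dz_mx i (h i) x - (s i x)^t* *m ((A i x)^t* *m h i x).
  rewrite [LHS]mulmxA (mul_adj_h s mh ix) -[LHS]mulmxA (mul_chern10 A mh ix).
  exact: mulmxBr.
rewrite /end10 /end01 /lie scale1r ctrD ctrB !ctrM mulmxDr mulmxBr e1 e2.
rewrite mulmxDl mulmxBl -!mulmxA (canRL (addKr _) dha).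
by mx_linear.
Qed.

(** The gluing law of the metric is differentiated in z_i, and the conjugate transpose of the gluing
    law of [A] is substituted in the result. *)
Lemma chern10_law h A : is_metric E h -> is_operator01 E A ->
  is_operator10 E 1 (chern10 A h).
Proof.
move=> mh [sA lA]; split=> [|i j x ix jx]; first exact: smooth_chern10.
have [sh _ th] := mh.
set T := trans E i j.
have oD : open (dom i `&` dom j) by apply: openI; exact: rs_dom_open.
have dT : diff_mx i T x by apply: smooth_diff_mx (trans_smooth E i j) _.
have dTJ := diff_mxJ dT.
have dh := metric_diff mh ix.
have uT : T x \in unitmx.
  by rewrite unitmxE (trans_det E ix jx) unitr1.
have uTJ : (T x)^t* \in unitmx.
  by rewrite unitmxE det_map_mx det_tr (trans_det E ix jx) rmorph1 unitr1.
(* The chain rule converts the derivative of [h j] from z_i to z_j. *)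
have dzh : jac i j x *: dz_mx j (h j) x =
    ((dzbar_mx i T x)^t* *m h i x + (T x)^t* *m dz_mx i (h i) x) *m T x +
    ((T x)^t* *m h i x) *m dz_mx i T x.
  transitivity (dz_mx i (h j) x).
    by apply/matrixP => a b; rewrite !mxE -dz_chain//; exact: sh.
  rewrite -(dzJ dT) !dz_mxE.
  rewrite -(der_mxM _ ix dTJ dh) -(der_mxM _ ix _ dT); last exact: diff_mxM.
  apply: (eq_der_mx _ oD _ ix) => // y [iy jy].
  by rewrite -(th i j y iy jy).
have AT : jac i j x *: ((A j x)^t* *m (T x)^t*) =
    (T x)^t* *m (A i x)^t* + (dzbar_mx i T x)^t*.
  have := congr1 (fun M => M^t*) (lA i j x ix jx).
  rewrite /= ctrB ctrZ !ctrM conjCK => ->.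
  by rewrite subrK.
have hB := mul_chern10 A mh ix; have hBj := mul_chern10 A mh jx.
rewrite -[LHS](mulKmx (metric_unit mh ix)) -[RHS](mulKmx (metric_unit mh ix)).
(* Both sides have now been multiplied by the invertible matrices [h i x] and the conjugate
   transpose of [T x], to reach the metric relations. *)
congr (_ *m _); rewrite -[LHS](mulKmx uTJ) -[RHS](mulKmx uTJ); congr (_ *m _).
have e1 : h i x *m (chern10 A h i x *m T x) =
    dz_mx i (h i) x *m T x - (A i x)^t* *m (h i x *m T x).
  by rewrite mulmxA hB mulmxBl -[(A i x)^t* *m h i x *m _]mulmxA.
have e2 : (T x)^t* *m (h i x *m (T x *m chern10 A h j x)) =
    dz_mx j (h j) x - (A j x)^t* *m h j x.
  by rewrite -hBj -(th i j x ix jx) -!mulmxA.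
have e3 : jac i j x *: ((A j x)^t* *m h j x) =
    (T x)^t* *m ((A i x)^t* *m (h i x *m T x)) + (dzbar_mx i T x)^t* *m (h i x *m T x).
  rewrite -(th i j x ix jx) -[(T x)^t* *m h i x *m T x]mulmxA mulmxA scalemxAl AT.
  by rewrite mulmxDl -mulmxA.
rewrite scale1r [in RHS]mulmxBr [in RHS]mulmxBr -!scalemxAr e2 scalerBr dzh e3 e1.
rewrite mulmxBr mulmxDl -!mulmxA.
by mx_linear.
Qed.

(** By Jacobi's formula the trace of h^-1 dh is the derivative of [\det h], which is constantly
    1. *)
Lemma mxtrace_chern10 h A i x : is_metric E h -> dom i x ->
  \tr (A i x) = 0 -> \tr (chern10 A h i x) = 0.
Proof.
move=> mh ix trA; have dh := metric_diff mh ix.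
rewrite /chern10 mulmxBr linearB /= [\tr (_ *m (_ *m _))]mxtrace_mulC.
rewrite -mulmxA (mulmxV (metric_unit mh ix)).
rewrite mulmx1 mxtrace_ctr trA rmorph0 subr0 (metric_inv mh ix) dz_mxE.
rewrite -(der_det _ ix dh).
rewrite -(der_cst (- 'i) i 1 x); apply: (eq_der _ (@rs_dom_open _ X i) ix ix) => y iy.
by have [_ /(_ i y iy)[_ -> _] _] := mh.
Qed.

Lemma adj_h_form01 h s : is_metric E h -> is_form10 E s -> is_form01 E (adj_h h s).
Proof.
move=> mh [ss ls]; split=> [|i j x ix jx]; first exact: smooth_adj_h.
have [sh _ th] := mh; set T := trans E i j x.
have uTJ : T^t* \in unitmx.
  by rewrite unitmxE det_map_mx det_tr (trans_det E ix jx) rmorph1 unitr1.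
rewrite -[LHS](mulKmx (metric_unit mh ix)) -[RHS](mulKmx (metric_unit mh ix)).
congr (_ *m _); rewrite -[LHS](mulKmx uTJ) -[RHS](mulKmx uTJ); congr (_ *m _).
rewrite -!scalemxAr [h i x *m (_ *m T)]mulmxA (mul_adj_h s mh ix).
rewrite [h i x *m (T *m _)]mulmxA [T^t* *m (h i x *m T *m _)]mulmxA.
rewrite [T^t* *m (h i x *m T)]mulmxA (th i j x ix jx) (mul_adj_h s mh jx).
rewrite !mulmxA -ctrM (ls i j x ix jx) ctrZ ctrM -!scalemxAl.
by rewrite -(th i j x ix jx) !mulmxA.
Qed.

End HermitianMetric.

(** * Gauge transformations *)

Section ConjugationAlgebra.
Context {K : fieldType} {n : nat}.
Implicit Types g k B p dg dk dp : 'M[K]_n.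

(* [B1 *m g = g *m B - dg] is the relation between the coefficients of an
   operator and of its conjugate by [g]; [dg], [dk], [dp] stand for derivatives. *)

Lemma conj_rel_inv g k B B1 dg dk : g *m k = 1%:M -> k *m g = 1%:M ->
  dk *m g + k *m dg = 0 -> B1 *m g = g *m B - dg -> B *m k = k *m B1 - dk.
Proof.
move=> gk kg dkg e.
have {}dkg : dk = - (k *m dg *m k).
  by rewrite -[dk]mulmx1 -gk mulmxA -mulNmx; congr (_ *m _); apply/eqP; rewrite -addr_eq0 dkg.
have -> : B1 = (g *m B - dg) *m k by rewrite -e -mulmxA gk mulmx1.
rewrite dkg opprK [k *m (_ *m k)]mulmxA mulmxBr mulmxA kg mul1mx mulmxBl.
by rewrite subrK.
Qed.

Lemma conj_rel_mul g k B B1 B2 dg dk :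
  B1 *m g = g *m B - dg -> B2 *m k = k *m B1 - dk ->
  B2 *m (k *m g) = k *m g *m B - (dk *m g + k *m dg).
Proof.
move=> e1 e2; rewrite mulmxA e2 mulmxBl -[k *m B1 *m g]mulmxA e1 mulmxBr mulmxA.
by rewrite opprD addrCA addrC.
Qed.

(** The first three terms are the product rule for [g *m p *m k], with [k] the inverse of [g]:
    covariant derivatives of endomorphisms are conjugated by [g]. *)
Lemma conj_rel_endo g k B B1 p dg dk dp : g *m k = 1%:M -> k *m g = 1%:M ->
  dk *m g + k *m dg = 0 -> B1 *m g = g *m B - dg ->
  dg *m p *m k + g *m dp *m k + g *m p *m dk + lie B1 (g *m p *m k) =
  g *m (dp + lie B p) *m k.
Proof.
move=> gk kg dkg e.
have {}dkg : dk = - (k *m dg *m k).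
  by rewrite -[dk]mulmx1 -gk mulmxA -mulNmx; congr (_ *m _); apply/eqP; rewrite -addr_eq0 dkg.
have eB : k *m B1 = B *m k - k *m dg *m k.
  have -> : B1 = (g *m B - dg) *m k by rewrite -e -mulmxA gk mulmx1.
  by rewrite mulmxA mulmxBr mulmxA kg mul1mx mulmxBl.
rewrite /lie dkg [B1 *m _]mulmxA [B1 *m _]mulmxA e.
rewrite -[g *m p *m k *m B1]mulmxA eB.
rewrite !(mulmxDr, mulmxDl, mulmxN, mulNmx, mulmxA).
by mx_linear.
Qed.

(** The term left over by the product rule is [g *m p *m dk]; its columns lie in the image of the
    conjugated projector, so the complementary projector kills it. *)
Lemma conj_rel_sub g k B B1 p dg dk dp : g *m k = 1%:M -> k *m g = 1%:M ->
  B1 *m g = g *m B - dg -> p *m p = p ->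
  (1%:M - p) *m (dp + B *m p) = 0 ->
  (1%:M - g *m p *m k) *m (dg *m p *m k + g *m dp *m k + g *m p *m dk +
    B1 *m (g *m p *m k)) = 0.
Proof.
move=> gk kg e pp h.
have -> : dg *m p *m k + g *m dp *m k + g *m p *m dk + B1 *m (g *m p *m k) =
    g *m (dp + B *m p) *m k + g *m (p *m dk).
  rewrite [B1 *m _]mulmxA [B1 *m _]mulmxA e !(mulmxDr, mulmxDl, mulmxN, mulNmx, mulmxA).
  by mx_linear.
have e1 : (1%:M - g *m p *m k) *m g = g *m (1%:M - p).
  by rewrite mulmxBl mulmxBr mul1mx mulmx1 -[g *m p *m k *m g]mulmxA kg mulmx1.
rewrite mulmxDr !mulmxA e1 -[g *m _ *m (dp + _)]mulmxA h mulmx0 mul0mx add0r.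
by rewrite -[g *m _ *m p]mulmxA mulmxBl mul1mx pp subrr mulmx0 mul0mx.
Qed.

End ConjugationAlgebra.

Section Gauge.
Context {R : realType} {X : riemann_surface R} {n : nat} (E : su_bundle X n).
Implicit Types (i j : chart X) (x : X) (g k p q : coefs X n) (c : @lconn R X n).

Lemma endo_diff g i x : is_endo E g -> dom i x -> diff_mx i (g i) x.
Proof. by move=> [sg _] ix; exact: smooth_diff_mx (sg i) ix. Qed.

Lemma endo_mul g k : is_endo E g -> is_endo E k -> is_endo E (fun i x => g i x *m k i x).
Proof.
move=> [sg lg] [sk lk]; split=> [i|i j x ix jx]; first exact: smooth_mxM.
by rewrite -mulmxA (lk i j x ix jx) mulmxA (lg i j x ix jx) mulmxA.
Qed.

Lemma endo_cst (a : R[i]) : is_endo E (fun _ _ => a%:M).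
Proof.
split=> [i|i j x ix jx]; first exact: smooth_mx_cst.
by rewrite scalar_mxC.
Qed.

Lemma det1_mulmxV g i x : \det (g i x) = 1 -> g i x *m invmx (g i x) = 1%:M.
Proof. by move=> d; rewrite mulmxV// unitmxE d unitr1. Qed.

Lemma det1_mulVmx g i x : \det (g i x) = 1 -> invmx (g i x) *m g i x = 1%:M.
Proof. by move=> d; rewrite mulVmx// unitmxE d unitr1. Qed.

Lemma endo_inv g : is_endo E g -> (forall i x, dom i x -> \det (g i x) = 1) ->
  is_endo E (fun i x => invmx (g i x)).
Proof.
move=> [sg lg] dg; split=> [i|i j x ix jx].
  apply: (eq_smooth_mx _ (smooth_mx_adj (sg i))) => x ix.
  by rewrite /invmx unitmxE (dg i x ix) unitr1 invr1 scale1r.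
have ui : g i x \in unitmx by rewrite unitmxE (dg i x ix) unitr1.
rewrite -[RHS](mulKmx ui); congr (_ *m _).
by rewrite mulmxA (lg i j x ix jx) -mulmxA (det1_mulmxV (dg j x jx)) mulmx1.
Qed.

Lemma der_inv g e i x : is_endo E g -> (forall i x, dom i x -> \det (g i x) = 1) ->
  dom i x ->
  der_mx e i (fun y => invmx (g i y)) x *m g i x + invmx (g i x) *m der_mx e i (g i) x = 0.
Proof.
move=> eg dg ix.
rewrite -(der_mxM e ix (endo_diff (endo_inv eg dg) ix) (endo_diff eg ix)).
rewrite -(der_mx_cst e i (1%:M : 'M[R[i]]_n) x).
apply: (eq_der_mx _ (@rs_dom_open _ X i) ix ix) => y iy.
exact: det1_mulVmx (dg i y iy).
Qed.

Lemma der_conj g p e i x : is_endo E g -> is_endo E p ->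
  (forall i x, dom i x -> \det (g i x) = 1) -> dom i x ->
  der_mx e i (fun y => g i y *m p i y *m invmx (g i y)) x =
  der_mx e i (g i) x *m p i x *m invmx (g i x) +
  g i x *m der_mx e i (p i) x *m invmx (g i x) +
  g i x *m p i x *m der_mx e i (fun y => invmx (g i y)) x.
Proof.
move=> eg ep dg ix.
have d1 := endo_diff eg ix; have d2 := endo_diff ep ix.
have d3 := endo_diff (endo_inv eg dg) ix.
by rewrite (der_mxM e ix (diff_mxM d1 d2) d3) (der_mxM e ix d1 d2) mulmxDl.
Qed.

(** The factor [1 *:] gives both relations the same shape, so that a single computation with a
    scalar [mu] covers them. *)
Definition gauge_by g c c' : Prop :=
  [/\ lam c' = lam c, is_endo E g, forall i x, dom i x -> \det (g i x) = 1 &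
  forall i x, dom i x ->
    c01 c' i x *m g i x = g i x *m c01 c i x - 1 *: der_mx 'i i (g i) x /\
    c10 c' i x *m g i x = g i x *m c10 c i x - lam c *: der_mx (- 'i) i (g i) x].

Lemma gauge_equivP c c' : gauge_equiv E c c' <-> exists g, gauge_by g c c'.
Proof.
split=> [[lc [g [eg dg h1 h2]]]|[g [lc eg dg h]]].
  by exists g; split=> // i x ix; rewrite scale1r -dz_mxE -dzbar_mxE h1// h2.
split=> //; exists g; split=> // i x ix; have [h1 h2] := h i x ix.
  by rewrite h1 scale1r dzbar_mxE.
by rewrite h2 dz_mxE.
Qed.

Lemma gauge_by_sym g c c' :
  gauge_by g c c' -> gauge_by (fun i x => invmx (g i x)) c' c.
Proof.
move=> [lc eg dg h]; split=> [//||i x ix|i x ix]; first exact: endo_inv.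
  by rewrite det_inv dg// invr1.
have gk := det1_mulmxV (dg i x ix); have kg := det1_mulVmx (dg i x ix).
have [h1 h2] := h i x ix; rewrite lc.
have rel mu e : mu *: der_mx e i (fun y => invmx (g i y)) x *m g i x +
    invmx (g i x) *m (mu *: der_mx e i (g i) x) = 0.
  by rewrite -scalemxAl -scalemxAr -scalerDr (der_inv e eg dg ix) scaler0.
split; first exact: conj_rel_inv gk kg (rel 1 'i) h1.
exact: conj_rel_inv gk kg (rel (lam c) (- 'i)) h2.
Qed.

Lemma gauge_by_trans g k c c' c'' : gauge_by g c c' -> gauge_by k c' c'' ->
  gauge_by (fun i x => k i x *m g i x) c c''.
Proof.
move=> [l1 eg dg h] [l2 ek dk h']; split=> [||i x ix|i x ix].
- by rewrite l2.
- exact: endo_mul.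
- by rewrite det_mulmx dg// dk// mulr1.
have [h1 h2] := h i x ix; have [h3 h4] := h' i x ix.
have e mu a : mu *: der_mx a i (fun y => k i y *m g i y) x =
    mu *: der_mx a i (k i) x *m g i x + k i x *m (mu *: der_mx a i (g i) x).
  rewrite (der_mxM a ix (endo_diff ek ix) (endo_diff eg ix)) scalerDr.
  by rewrite scalemxAl scalemxAr.
rewrite !e; split; first exact: conj_rel_mul h1 h3.
by rewrite l1 in h4; exact: conj_rel_mul h2 h4.
Qed.

Lemma eq_hod_class (c c' : plconn E) :
  gauge_equiv E (sval c) (sval c') -> hod_class c = hod_class c'.
Proof.
move=> /gauge_equivP[g cc'].
have e : gauge_class c = gauge_class c'.
  apply/seteqP; split=> d /= /gauge_equivP[k cd]; apply/gauge_equivP.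
    by eexists; exact: gauge_by_trans (gauge_by_sym cc') cd.
  by eexists; exact: gauge_by_trans cc' cd.
by apply: eq_exist.
Qed.

Definition conj_by g p : coefs X n := fun i x => g i x *m p i x *m invmx (g i x).

Lemma endo_conj g p : is_endo E g -> (forall i x, dom i x -> \det (g i x) = 1) ->
  is_endo E p -> is_endo E (conj_by g p).
Proof. by move=> eg dg ep; apply: endo_mul (endo_inv eg dg); exact: endo_mul. Qed.

Lemma conj_by_mul g p q i x : \det (g i x) = 1 ->
  conj_by g p i x *m conj_by g q i x = g i x *m (p i x *m q i x) *m invmx (g i x).
Proof.
move=> d; rewrite /conj_by !mulmxA -[_ *m invmx _ *m g i x]mulmxA.
by rewrite (det1_mulVmx d) mulmx1.
Qed.

Lemma mxrank_conj_by g p i x : \det (g i x) = 1 -> \rank (conj_by g p i x) = \rank (p i x).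
Proof.
move=> d; have u : g i x \in unitmx by rewrite unitmxE d unitr1.
rewrite /conj_by mxrankMfree ?row_free_unit ?unitmx_inv//.
by rewrite eqmxMfull// row_full_unit.
Qed.

Lemma invariant_conj g c c' p : gauge_by g c c' ->
  invariant_subbundle E c p -> invariant_subbundle E c' (conj_by g p).
Proof.
move=> [lc eg dg h] [[ep pp] hp]; split=> [|i x ix].
  split=> [|i x ix]; first exact: endo_conj.
  by rewrite (conj_by_mul _ _ (dg i x ix)) (pp i x ix).
have [h1 h2] := h i x ix; have [p1 p2] := hp i x ix.
have gk := det1_mulmxV (dg i x ix); have kg := det1_mulVmx (dg i x ix).
rewrite dzbar_mxE dz_mxE; rewrite dzbar_mxE in p1; rewrite dz_mxE in p2.
have e mu a : mu *: der_mx a i (conj_by g p i) x =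
    (mu *: der_mx a i (g i) x) *m p i x *m invmx (g i x) +
    g i x *m (mu *: der_mx a i (p i) x) *m invmx (g i x) +
    g i x *m p i x *m (mu *: der_mx a i (fun y => invmx (g i y)) x).
  rewrite (der_conj a eg ep dg ix) !scalerDr.
  by rewrite -!(scalemxAl, scalemxAr).
rewrite -[der_mx 'i i _ x]scale1r in p1.
rewrite lc -[der_mx 'i i _ x]scale1r !e; split.
  exact: conj_rel_sub gk kg h1 (pp i x ix) p1.
exact: conj_rel_sub gk kg h2 (pp i x ix) p2.
Qed.

(* The part of the definition of a reductive connection which makes sense for
   every lambda-connection. *)
Definition split_irreducible c : Prop :=
  exists m (p : 'I_m -> coefs X n), direct_sum E c p /\
    forall (a : 'I_m) q, invariant_subbundle E c q -> ~ proper_subbundle q (p a).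

(** This condition involves no degree, so its transport is algebra: projectors are conjugated by
    [g], and an invariant subbundle of a conjugated summand is pulled back by the inverse of [g]. *)
Lemma split_irreducible_gauge g c c' :
  gauge_by g c c' -> split_irreducible c -> split_irreducible c'.
Proof.
move=> cc'; have [lc eg dg h] := cc'.
move=> [m [p [[ep dp] irr]]]; exists m, (fun a => conj_by g (p a)); split.
  split=> [a|i x ix]; first exact: endo_conj.
  have [rk orth sum d1 d2] := dp i x ix; have d := dg i x ix.
  have gk := det1_mulmxV d; have kg := det1_mulVmx d.
  have [h1 h2] := h i x ix.
  have rel mu e : mu *: der_mx e i (fun y => invmx (g i y)) x *m g i x +
      invmx (g i x) *m (mu *: der_mx e i (g i) x) = 0.
    by rewrite -scalemxAl -scalemxAr -scalerDr (der_inv e eg dg ix) scaler0.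
  have e mu b a : mu *: der_mx b i (conj_by g (p a) i) x =
      (mu *: der_mx b i (g i) x) *m p a i x *m invmx (g i x) +
      g i x *m (mu *: der_mx b i (p a i) x) *m invmx (g i x) +
      g i x *m p a i x *m (mu *: der_mx b i (fun y => invmx (g i y)) x).
    rewrite (der_conj b eg (ep a) dg ix) !scalerDr.
    by rewrite -!(scalemxAl, scalemxAr).
  split=> [a|a a'||a|a].
  - by rewrite mxrank_conj_by.
  - by rewrite conj_by_mul// orth; case: eqP => // _; rewrite mulmx0 mul0mx.
  - by rewrite /conj_by -mulmx_suml -mulmx_sumr sum mulmx1.
  - rewrite /end01 dzbar_mxE -[der_mx _ _ _ _]scale1r e.
    rewrite (conj_rel_endo _ _ gk kg (rel 1 'i) h1).
    by rewrite scale1r -dzbar_mxE -/(end01 _ _ _ _) d1 mulmx0 mul0mx.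
  - rewrite /end10 dz_mxE lc e (conj_rel_endo _ _ gk kg (rel _ _) h2).
    by rewrite -dz_mxE -/(end10 _ _ _ _ _) d2 mulmx0 mul0mx.
move=> a q inv_q prop_q.
apply: (irr a _ (invariant_conj (gauge_by_sym cc') inv_q)) => i x ix.
have [pq r0 rl] := prop_q i x ix; have d := dg i x ix.
have d' : \det (invmx (g i x)) = 1 by rewrite det_inv d invr1.
rewrite (mxrank_conj_by (g := fun i x => invmx (g i x)))//; split=> //.
  have kg := det1_mulVmx d; have gk := det1_mulmxV d.
  rewrite /conj_by invmxK -{2}pq /conj_by !mulmxA; congr (_ *m _ *m _).
  by rewrite kg mul1mx.
by rewrite -[X in (_ < X)%N](mxrank_conj_by (p a) d).
Qed.

(** Either [xget] picks the value of a dissection, all of whose terms vanish, or it returns its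
    default value 0. *)
Lemma integral2_eq0 (w : chart X -> X -> R) :
  (forall i x, dom i x -> w i x = 0) -> integral2 w = 0.
Proof.
move=> w0; rewrite /integral2; case: xgetP => // v _ [m [c [S [[_ _ Sd _ _] ->]]]].
apply: big1 => k _; rewrite /Rintegral integral0_eq// => _ [x Sx <-].
by rewrite rs_crdK ?w0//; exact: Sd.
Qed.

(** The degree may be computed with any connection. A flat one whose (1,0)-part preserves [p]
    annihilates both terms of the Chern density. *)
Lemma flat_degree0 A B p : is_operator01 E A -> is_operator10 E 1 B ->
  (forall i x, dom i x -> curvature 1 A B i x = 0) ->
  (forall i x, dom i x -> end10 1 B p i x = 0) -> has_degree E p 0.
Proof.
move=> oA oB F0 dp; exists A, B; split=> //; apply/esym/integral2_eq0 => i x ix.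
by rewrite /chern_density F0// dp// /lie mul0mx mulmx0 !subr0 mulmx0 mxtrace0 mulr0.
Qed.

(** Dividing D by lambda yields a flat connection preserving each summand, which thus has degree 0;
    stability is vacuous since the summands contain no proper invariant subbundle. *)
Lemma split_irreducible_polystable c :
  is_lconn E c -> lam c != 0 -> split_irreducible c -> polystable E c.
Proof.
move=> [hA [s2 l2] _ F0] lc0 [m [p [dp irr]]]; exists m, p; split=> // a.
split; last by move=> q inv_q pq; case: (irr a q inv_q pq).
have [ep dps] := dp; set mu := lam c in lc0 *.
have d10 i x : dom i x -> diff_mx i (c10 c i) x.
  by move=> ix; exact: smooth_diff_mx (s2 i) ix.
apply: (@flat_degree0 (c01 c) (fun i x => mu^-1 *: c10 c i x) (p a) hA).
- split=> [i|i j x ix jx]; first exact: smooth_mxZ.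
  rewrite -scalemxAl (l2 i j x ix jx) scalerBr -scalemxAr !scalerA -/mu.
  by rewrite (mulVf lc0) [mu^-1 * _]mulrC.
- move=> i x ix; have F := F0 i x ix.
  rewrite /curvature dzbar_mxE (der_mxZ _ _ ix (d10 i x ix)) scale1r.
  apply: (scalerI lc0); rewrite scaler0 -F /curvature dzbar_mxE -/mu.
  rewrite scalerDr scalerBr scalerA divff// scale1r; congr (_ + _).
  by rewrite /lie -scalemxAl -scalemxAr -scalerBr scalerA divff// scale1r.
- move=> i x ix; have [_ _ _ _ /(_ a) d2] := dps i x ix.
  apply: (scalerI lc0); rewrite scaler0 -d2 /end10 scale1r scalerDr; congr (_ + _).
  by rewrite /lie -scalemxAl -scalemxAr -scalerBr scalerA divff// scale1r.
Qed.

End Gauge.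

(** * Locally constant functions *)

Section LocallyConstant.
Context {R : realType}.

Lemma zero_partials_locally_constant (V : set (R * R)) (u : R * R -> R) (q : R * R) :
  open V -> real_smooth_on V u -> V q ->
  (forall p, V p -> forall b, iter_partial [:: b] u p = 0) ->
  \forall p \near q, u p = u q.
Proof.
move=> oV su Vq u0.
have /nbhs_ballP[r /= r0 B] : nbhs q V by exact: open_nbhs_nbhs.
apply/nbhs_ballP; exists r => // p qp; set h := p - q.
have hr : `|h| < r by move: qp; rewrite -ball_normE /= distrC.
have n1 : `|h.1| <= `|h| by rewrite /Num.norm /= le_max lexx.
have n2 : `|h.2| <= `|h| by rewrite /Num.norm /= le_max lexx orbT.
have VB (a b : R) : `|a| <= `|h| -> `|b| <= `|h| -> V ((a, b) + q).
  move=> ah bh; apply: B; rewrite -ball_normE /= opprD addrCA subrr addr0 normrN.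
  by apply: le_lt_trans hr; rewrite {1}/Num.norm /= ge_max ah bh.
have dV p0 b : V p0 -> derivable u p0 (axis b).
  by move=> Vp; have [_ /(_ b)] := su [::] p0 Vp.
pose p2 := h.2 *: axis true + q.
have E1 (t : R) : t *: axis false + p2 = (t, h.2) + q.
  by rewrite /p2 /axis addrA; congr (_ + q); congr pair; rewrite /= /GRing.scale /=; ring.
have E2 (t : R) : t *: axis true + q = (0, t) + q.
  by rewrite /axis; congr (_ + q); congr pair; rewrite /= /GRing.scale /=; ring.
have S1 : `|u (h.1 *: axis false + p2) - u (0 *: axis false + p2) - 0 * h.1| <= 0 * `|h.1|.
  apply: (mean_value_le (g := fun s => u (s *: axis false + p2))
    (dg := fun s => 'D_(axis false) u (s *: axis false + p2))) => t th.
  have Vt : V (t *: axis false + p2) by rewrite E1; apply: VB => //; exact: le_trans n1.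
  split; first by apply: is_derive_line; exact: dV.
  by rewrite [X in `|X - _|](u0 _ Vt false) subr0 normr0.
have S2 : `|u (h.2 *: axis true + q) - u (0 *: axis true + q) - 0 * h.2| <= 0 * `|h.2|.
  apply: (mean_value_le (g := fun s => u (s *: axis true + q))
    (dg := fun s => 'D_(axis true) u (s *: axis true + q))) => t th.
  have Vt : V (t *: axis true + q).
    by rewrite E2; apply: VB; [rewrite normr0|exact: le_trans n2].
  split; first by apply: is_derive_line; exact: dV.
  by rewrite [X in `|X - _|](u0 _ Vt true) subr0 normr0.
move: S1 S2; rewrite !mul0r !subr0 !normr_le0 !scale0r !add0r -/p2 !subr_eq0.
move=> /eqP S1 /eqP S2; rewrite -S2 -S1 E1 -surjective_pairing /h subrK.
by [].
Qed.

Context {X : riemann_surface R}.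

(** The level set of [x] is open, and so is its complement, a union of other level sets;
    connectedness concludes. *)
Lemma locally_constant_eq (T : Type) (f : X -> T) :
  (forall x, \forall y \near x, f y = f x) -> forall x y, f x = f y.
Proof.
move=> lf x y; apply/esym.
have op v : open [set z | f z = v].
  by rewrite openE => z /= <-; exact: lf.
have : [set z | f z = f x] = [set: X].
  apply: rs_connected; first by exists x.
    by exists [set z | f z = f x]; rewrite ?setTI.
  exists [set z | f z = f x]; rewrite ?setTI//.
  rewrite -(setCK [set z | f z = f x]); apply: open_closedC.
  rewrite (_ : ~` _ = \bigcup_(v in [set v | v <> f x]) [set z | f z = v]).
    by apply: bigcup_open => v _; exact: op.
  by apply/seteqP; split=> [z /= zx|z [v /= vx zv] zx]; [exists (f z)|case: vx; rewrite -zv].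
by move=> /seteqP[_ /(_ y I)].
Qed.

Transparent der.

Lemma zero_der_locally_constant (i : chart X) (f : X -> R[i]) x :
  dom i x -> smooth_in i (dom i) f ->
  (forall y, dom i y -> der 'i i f y = 0 /\ der (- 'i) i f y = 0) ->
  \forall y \near x, f y = f x.
Proof.
move=> ix sf df; have [s1 s2] := sf.
have oV : open (crd i @` dom i) by exact: rs_img_open.
have d0 p : (crd i @` dom i) p -> forall b,
    iter_partialC [:: b] (fun q => f (par i q)) p = 0.
  move=> [y iy <-]; have [] := df y iy; rewrite /der /dw.
  set a0 := iter_partialC [:: false] _ _; set a1 := iter_partialC [:: true] _ _.
  move=> /eqP; rewrite mulf_eq0 invr_eq0 pnatr_eq0 orbF => /eqP h1.
  move=> /eqP; rewrite mulf_eq0 invr_eq0 pnatr_eq0 orbF => /eqP h2.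
  have i0 : ('i : R[i]) != 0 by rewrite eq_complex /= oner_eq0 andbF.
  have a10 : a1 = 0.
    have : (a0 + 'i * a1) - (a0 + - 'i * a1) = 0 by rewrite h1 h2 subrr.
    rewrite mulNr opprB addrA addrC !addrA addNr add0r -mulr2n.
    by move=> /eqP; rewrite mulrn_eq0 /= mulf_eq0 (negbTE i0) => /eqP.
  by case; [exact: a10|move: h1; rewrite a10 mulr0 addr0].
have Vx : (crd i @` dom i) (crd i x) by exists x.
have xK : par i (crd i x) = x by exact: rs_crdK.
have l1 := zero_partials_locally_constant oV s1 Vx
  (fun p Vp b => congr1 (@complex.Re R) (d0 p Vp b)).
have l2 := zero_partials_locally_constant oV s2 Vx
  (fun p Vp b => congr1 (@complex.Im R) (d0 p Vp b)).
have cx : crd i @ x --> crd i x by exact: rs_crd_cont.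
have nx : nbhs x (dom i) by apply: open_nbhs_nbhs; split=> //; exact: rs_dom_open.
near=> y.
have iy : dom i y by near: y.
have e1 : complex.Re (f (par i (crd i y))) = complex.Re (f (par i (crd i x))).
  by near: y; exact: cx l1.
have e2 : complex.Im (f (par i (crd i y))) = complex.Im (f (par i (crd i x))).
  by near: y; exact: cx l2.
move: e1 e2; rewrite xK rs_crdK//.
by case: (f y) (f x) => a b [c d] /= -> ->.
Unshelve. all: by end_near. Qed.

Opaque der.

End LocallyConstant.

(** Both products of [N] with its adjugate equal the scalar [\det N], so cyclicity of the trace
    cancels the two terms. With Jacobi's formula, this makes the determinant of a parallel section
    have zero derivative. *)
Lemma mxtrace_adj_lie (K : fieldType) n (B N : 'M[K]_n) :
  \tr (\adj N *m - lie B N) = 0.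
Proof.
have e : \tr (\adj N *m (B *m N)) = \tr (\adj N *m (N *m B)).
  by rewrite mulmxA mxtrace_mulC mulmxA mul_mx_adj [in RHS]mulmxA mul_adj_mx.
by rewrite /lie mulmxN mulmxBr raddfN raddfB /= e subrr oppr0.
Qed.

Section ParallelDeterminant.
Context {R : realType} {X : riemann_surface R} {n : nat} (E : su_bundle X n).
Implicit Types (i j : chart X) (x : X) (A B M : coefs X n).

Lemma parallel_det_cst A B M i j x y : is_endo E M ->
  (forall i x, dom i x -> end01 A M i x = 0) ->
  (forall i x, dom i x -> end10 1 B M i x = 0) ->
  dom i x -> dom j y -> \det (M i x) = \det (M j y).
Proof.
move=> [sM lM] d01 d10.
have ch z : exists k : chart X, dom k z by exact: rs_cover.
(* A choice of chart at every point makes the determinant a function on all of X; [eqM] says that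
   the choice does not affect its value. *)
pose c z := projT1 (cid (ch z)).
have cP z : dom (c z) z by exact: (projT2 (cid (ch z))).
have eqM k k' z : dom k z -> dom k' z -> \det (M k z) = \det (M k' z).
  move=> kz kz'; have := congr1 (fun N : 'M[_]_n => \det N) (lM k k' z kz kz').
  by rewrite /= !det_mulmx (trans_det E kz kz') mulr1 mul1r.
suff H z1 z2 : \det (M (c z1) z1) = \det (M (c z2) z2).
  by move=> ix jy; rewrite (eqM i (c x)) ?(eqM j (c y)).
apply: (@locally_constant_eq _ _ _ (fun z => \det (M (c z) z))) => z.
have kz := cP z; set k := c z in kz *.
have Dz : \forall z' \near z, \det (M k z') = \det (M k z).
  apply: (zero_der_locally_constant kz).
    rewrite /smooth_in; apply: smooth_on_sum => [|s _]; first exact: rs_img_open.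
    apply: smooth_onM; [exact: rs_img_open|exact: smooth_on_cst|].
    by apply: smooth_on_prod => [|a _]; [exact: rs_img_open|exact: sM].
  move=> z' kz'; have dM : diff_mx k (M k) z' by exact: smooth_diff_mx (sM k) kz'.
  rewrite !(der_det _ kz' dM).
  have /eqP := d01 k z' kz'; rewrite /end01 dzbar_mxE addr_eq0 => /eqP ->.
  have /eqP := d10 k z' kz'; rewrite /end10 dz_mxE scale1r addr_eq0 => /eqP ->.
  by split; exact: mxtrace_adj_lie.
have nk : nbhs z (dom k) by apply: open_nbhs_nbhs; split=> //; exact: rs_dom_open.
near=> z'; have kz' : dom k z' by near: z'.
by rewrite (eqM (c z') k)//; near: z'.
Unshelve. all: by end_near. Qed.

End ParallelDeterminant.

(** * Gradings and curvature *)

Section Weights.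
Context {K : fieldType} {n l : nat} (P : 'I_l -> 'M[K]_n).
Context (orthP : forall a b, P a *m P b = if a == b then P a else 0).
Context (sumP : \sum_a P a = 1%:M).
Implicit Types (nu : K) (psi : 'M[K]_n).

(** It acts by nu^a on the image of [P a], so that conjugation by it scales every degree of the
    grading. Indices start at 0 here instead of 1; only their differences matter. *)
Definition weight nu : 'M[K]_n := \sum_(a < l) nu ^+ a *: P a.

Lemma weight_projr nu a : weight nu *m P a = nu ^+ a *: P a.
Proof.
rewrite mulmx_suml (bigD1 a)//= -scalemxAl orthP eqxx big1 ?addr0// => b ba.
by rewrite -scalemxAl orthP (negbTE ba) scaler0.
Qed.

Lemma weight_projl nu a : P a *m weight nu = nu ^+ a *: P a.
Proof.
rewrite mulmx_sumr (bigD1 a)//= -scalemxAr orthP eqxx big1 ?addr0// => b ba.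
by rewrite -scalemxAr orthP eq_sym (negbTE ba) scaler0.
Qed.

Lemma weightV nu : nu != 0 -> weight nu *m weight nu^-1 = 1%:M.
Proof.
move=> nu0; rewrite {2}/weight mulmx_sumr -[RHS]sumP; apply: eq_bigr => a _.
by rewrite -scalemxAr weight_projr scalerA -exprMn mulVf// expr1n scale1r.
Qed.

Lemma block_ext (M N : 'M[K]_n) :
  (forall a b, P b *m M *m P a = P b *m N *m P a) -> M = N.
Proof.
have ex Q : Q = \sum_b \sum_a P b *m Q *m P a.
  transitivity ((\sum_b P b) *m Q *m (\sum_a P a)); first by rewrite sumP mul1mx mulmx1.
  by rewrite !mulmx_suml; apply: eq_bigr => b _; rewrite mulmx_sumr.
move=> e; rewrite (ex M) (ex N); apply: eq_bigr => b _; apply: eq_bigr => a _.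
exact: e.
Qed.

(** The blocks of a matrix of degree k go from index b + k to index b, where the weights are
    nu^(b+k) and nu^b. Placing the factor on this side avoids negative powers. *)
Lemma weight_raise nu psi k :
  (forall a b : 'I_l, (a : nat) != (b + k)%N -> P b *m psi *m P a = 0) ->
  psi *m weight nu = nu ^+ k *: (weight nu *m psi).
Proof.
move=> h; apply: block_ext => a b.
rewrite -scalemxAr -scalemxAl [P b *m (psi *m _)]mulmxA -[P b *m psi *m _ *m _]mulmxA.
rewrite weight_projr [P b *m (weight nu *m _)]mulmxA weight_projl.
rewrite -scalemxAr -!scalemxAl scalerA -exprD.
have [->|/h ->] := eqVneq (a : nat) (b + k)%N; first by rewrite addnC.
by rewrite !scaler0.
Qed.

Lemma weight_lower nu psi :
  (forall a b : 'I_l, (b : nat) != a.+1 -> P b *m psi *m P a = 0) ->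
  weight nu *m psi = nu *: (psi *m weight nu).
Proof.
move=> h; apply: block_ext => a b.
rewrite -scalemxAr -scalemxAl [P b *m (psi *m _)]mulmxA -[P b *m psi *m _ *m _]mulmxA.
rewrite weight_projr [P b *m (weight nu *m _)]mulmxA weight_projl.
rewrite -scalemxAr -!scalemxAl scalerA -exprS.
have [->//|/h ->] := eqVneq (b : nat) a.+1.
by rewrite !scaler0.
Qed.

End Weights.

(** * Sums of operators and forms, curvature of sums and of conjugates *)

Section OperatorAlgebra.
Context {R : realType} {X : riemann_surface R} {n : nat} (E : su_bundle X n).
Implicit Types (i j : chart X) (x : X) (A B s psi alpha : coefs X n) (mu : R[i]).

Lemma form01_lin mu s psi : is_form01 E s -> is_form01 E psi ->
  is_form01 E (fun i x => mu *: s i x + psi i x).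
Proof.
move=> [ss ls] [sp lp]; split=> [i|i j x ix jx].
  by apply: smooth_mxD (sp i); exact: smooth_mxZ.
rewrite mulmxDl mulmxDr scalerDr -scalemxAl -scalemxAr (ls i j x ix jx) (lp i j x ix jx).
by rewrite !scalerA mulrC.
Qed.

Lemma form10_lin mu s psi : is_form10 E s -> is_form10 E psi ->
  is_form10 E (fun i x => mu *: s i x + psi i x).
Proof.
move=> [ss ls] [sp lp]; split=> [i|i j x ix jx].
  by apply: smooth_mxD (sp i); exact: smooth_mxZ.
rewrite mulmxDl mulmxDr scalerDr -scalemxAl -scalemxAr (ls i j x ix jx) (lp i j x ix jx).
by rewrite !scalerA mulrC.
Qed.

Lemma form01_sum (m p : nat) (mu : nat -> R[i]) (s : nat -> coefs X n) :
  (forall k, (m <= k < p)%N -> is_form01 E (s k)) ->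
  is_form01 E (fun i x => \sum_(m <= k < p) mu k *: s k i x).
Proof.
move=> hs; split=> [i|i j x ix jx].
  (* The range is repeated as a predicate because [s k] is only known to be a form inside it. *)
  rewrite (_ : (fun x => _) = (fun x => \sum_(k <- index_iota m p | (m <= k < p)%N)
      mu k *: s k i x)).
    by apply: smooth_mx_sum => k /hs[sk _]; exact: smooth_mxZ.
  by apply/funext => x; rewrite big_nat.
rewrite mulmx_suml mulmx_sumr scaler_sumr !big_nat; apply: eq_bigr => k /hs[_ lk].
by rewrite -scalemxAl -scalemxAr (lk i j x ix jx) !scalerA mulrC.
Qed.

Lemma form10_sum (m p : nat) (mu : nat -> R[i]) (s : nat -> coefs X n) :
  (forall k, (m <= k < p)%N -> is_form10 E (s k)) ->
  is_form10 E (fun i x => \sum_(m <= k < p) mu k *: s k i x).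
Proof.
move=> hs; split=> [i|i j x ix jx].
  rewrite (_ : (fun x => _) = (fun x => \sum_(k <- index_iota m p | (m <= k < p)%N)
      mu k *: s k i x)).
    by apply: smooth_mx_sum => k /hs[sk _]; exact: smooth_mxZ.
  by apply/funext => x; rewrite big_nat.
rewrite mulmx_suml mulmx_sumr scaler_sumr !big_nat; apply: eq_bigr => k /hs[_ lk].
by rewrite -scalemxAl -scalemxAr (lk i j x ix jx) !scalerA mulrC.
Qed.

Lemma operator01D A s : is_operator01 E A -> is_form01 E s ->
  is_operator01 E (fun i x => A i x + s i x).
Proof.
move=> [sA lA] [ss ls]; split=> [i|i j x ix jx]; first exact: smooth_mxD.
rewrite mulmxDl mulmxDr scalerDr (lA i j x ix jx) (ls i j x ix jx).
by rewrite addrAC.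
Qed.

Lemma operator10D mu B s : is_operator10 E mu B -> is_form10 E s ->
  is_operator10 E mu (fun i x => B i x + s i x).
Proof.
move=> [sA lA] [ss ls]; split=> [i|i j x ix jx]; first exact: smooth_mxD.
rewrite mulmxDl mulmxDr scalerDr (lA i j x ix jx) (ls i j x ix jx).
by rewrite addrAC.
Qed.

Lemma operator10Z mu B : is_operator10 E 1 B ->
  is_operator10 E mu (fun i x => mu *: B i x).
Proof.
move=> [sB lB]; split=> [i|i j x ix jx]; first exact: smooth_mxZ.
rewrite -scalemxAl (lB i j x ix jx) scale1r scalerBr -scalemxAr !scalerA.
by rewrite [mu * _]mulrC.
Qed.

Lemma operator10_0 s : is_operator10 E 0 s -> is_form10 E s.
Proof.
by move=> [ss ls]; split=> // i j x ix jx; rewrite (ls i j x ix jx) scale0r subr0.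
Qed.

Lemma eq_operator01 A B : (forall i x, dom i x -> A i x = B i x) ->
  is_operator01 E A -> is_operator01 E B.
Proof.
move=> AB [sA lA]; split=> [i|i j x ix jx].
  by apply: eq_smooth_mx (sA i) => x; exact: AB.
by rewrite -!AB// lA.
Qed.

Lemma eq_operator10 mu A B : (forall i x, dom i x -> A i x = B i x) ->
  is_operator10 E mu A -> is_operator10 E mu B.
Proof.
move=> AB [sA lA]; split=> [i|i j x ix jx].
  by apply: eq_smooth_mx (sA i) => x; exact: AB.
by rewrite -!AB// lA.
Qed.

Lemma eq_curvature mu A B (A1 B1 : coefs X n) i x : dom i x ->
  (forall y, dom i y -> A i y = A1 i y) -> (forall y, dom i y -> B i y = B1 i y) ->
  curvature mu A B i x = curvature mu A1 B1 i x.
Proof.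
move=> ix eA eB; rewrite /curvature !dzbar_mxE !dz_mxE (eA x ix) (eB x ix).
rewrite (eq_der_mx _ (@rs_dom_open _ X i) ix ix eA).
by rewrite (eq_der_mx _ (@rs_dom_open _ X i) ix ix eB).
Qed.

Lemma curvatureZ mu A B i x : dom i x -> smooth_coefs B ->
  curvature mu A (fun i x => mu *: B i x) i x = mu *: curvature 1 A B i x.
Proof.
move=> ix sB; have dB : diff_mx i (B i) x by exact: smooth_diff_mx (sB i) ix.
rewrite /curvature dzbar_mxE (der_mxZ _ _ ix dB) -dzbar_mxE scale1r.
rewrite scalerDr scalerBr; congr (_ + _).
by rewrite /lie -scalemxAl -scalemxAr -scalerBr.
Qed.

Lemma curvature_expand A B alpha psi i x : dom i x ->
  smooth_coefs A -> smooth_coefs B -> smooth_coefs alpha -> smooth_coefs psi ->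
  curvature 1 (fun i x => A i x + alpha i x) (fun i x => B i x + psi i x) i x =
  curvature 1 A B i x + end01 A psi i x - end10 1 B alpha i x +
  lie (alpha i x) (psi i x).
Proof.
move=> ix sA sB sa sp.
have dA : diff_mx i (A i) x by exact: smooth_diff_mx (sA i) ix.
have dB : diff_mx i (B i) x by exact: smooth_diff_mx (sB i) ix.
have da : diff_mx i (alpha i) x by exact: smooth_diff_mx (sa i) ix.
have dp : diff_mx i (psi i) x by exact: smooth_diff_mx (sp i) ix.
rewrite /curvature /end01 /end10 !dzbar_mxE !dz_mxE !scale1r.
rewrite (der_mxD _ dA da) (der_mxD _ dB dp) /lie !(mulmxDl, mulmxDr).
move: (der_mx _ i (A i) x) (der_mx _ i (B i) x) => DA DB.
move: (der_mx _ i (alpha i) x) (der_mx _ i (psi i) x) => Da Dp.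
by mx_linear.
Qed.

(* As [g] commutes with the curvature of (A, B), the symmetry of second derivatives
   is not needed. *)
Lemma curvature_conj A B alpha psi g i x :
  is_endo E g -> (forall i x, dom i x -> \det (g i x) = 1) ->
  smooth_coefs A -> smooth_coefs B -> smooth_coefs alpha -> smooth_coefs psi ->
  (forall i x, dom i x -> end01 A g i x = 0) ->
  (forall i x, dom i x -> end10 1 B g i x = 0) ->
  dom i x -> g i x *m curvature 1 A B i x = curvature 1 A B i x *m g i x ->
  curvature 1 (fun i x => A i x + alpha i x) (fun i x => B i x + psi i x) i x = 0 ->
  curvature 1 (fun i x => A i x + conj_by g alpha i x)
    (fun i x => B i x + conj_by g psi i x) i x = 0.
Proof.
move=> eg dg sA sB sa sp g01 g10 ix gF F0.
have gk := det1_mulmxV (dg i x ix); have kg := det1_mulVmx (dg i x ix).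
have sg : smooth_coefs g by case: eg.
have sk : smooth_coefs (fun i x => invmx (g i x)) by case: (endo_inv eg dg).
have sconj s : smooth_coefs s -> smooth_coefs (conj_by g s).
  by move=> ss k; apply: smooth_mxM (sk k); exact: smooth_mxM.
have conj_der e (s : coefs X n) : smooth_coefs s ->
    der_mx e i (conj_by g s i) x =
    der_mx e i (g i) x *m s i x *m invmx (g i x) +
    g i x *m der_mx e i (s i) x *m invmx (g i x) +
    g i x *m s i x *m der_mx e i (fun y => invmx (g i y)) x.
  move=> ss; have d1 : diff_mx i (g i) x by exact: smooth_diff_mx (sg i) ix.
  have d2 : diff_mx i (s i) x by exact: smooth_diff_mx (ss i) ix.
  have d3 : diff_mx i (fun y => invmx (g i y)) x by exact: smooth_diff_mx (sk i) ix.
  by rewrite (der_mxM e ix (diff_mxM d1 d2) d3) (der_mxM e ix d1 d2) mulmxDl.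
(* A parallel [g] is a gauge transformation of the operator to itself, so the conjugation lemmas
   apply with [B1 = B]. *)
have parallel (C dgi : 'M[R[i]]_n) : dgi + lie C (g i x) = 0 ->
    C *m g i x = g i x *m C - dgi.
  by rewrite /lie => /eqP; rewrite addr_eq0 => /eqP ->; rewrite opprK subrKC.
have e01 : end01 A (conj_by g psi) i x = g i x *m end01 A psi i x *m invmx (g i x).
  rewrite /end01 !dzbar_mxE (conj_der _ _ sp).
  apply: (conj_rel_endo _ _ gk kg (der_inv _ eg dg ix)).
  by apply: parallel; rewrite -dzbar_mxE; exact: g01.
have e10 : end10 1 B (conj_by g alpha) i x =
    g i x *m end10 1 B alpha i x *m invmx (g i x).
  rewrite /end10 !dz_mxE !scale1r (conj_der _ _ sa).
  apply: (conj_rel_endo _ _ gk kg (der_inv _ eg dg ix)).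
  by apply: parallel; rewrite -dz_mxE -[dz_mx _ _ _]scale1r; exact: g10.
have elie : lie (conj_by g alpha i x) (conj_by g psi i x) =
    g i x *m lie (alpha i x) (psi i x) *m invmx (g i x).
  by rewrite /lie !conj_by_mul ?dg// mulmxBr mulmxBl.
have eF : curvature 1 A B i x = g i x *m curvature 1 A B i x *m invmx (g i x).
  by rewrite gF -mulmxA gk mulmx1.
rewrite (curvature_expand ix sA sB (sconj _ sa) (sconj _ sp)).
rewrite (curvature_expand ix sA sB sa sp) in F0.
rewrite e01 e10 elie eF -mulmxDl -mulmxBl -mulmxDl -mulmxDr -mulmxBr -mulmxDr.
by rewrite F0 mulmx0 mul0mx.
Qed.

Lemma end01_sum A (l : nat) (c : 'I_l -> R[i]) (s : 'I_l -> coefs X n) i x :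
  dom i x -> (forall a, smooth_coefs (s a)) ->
  end01 A (fun i x => \sum_a c a *: s a i x) i x = \sum_a c a *: end01 A (s a) i x.
Proof.
move=> ix ss.
have ds a : diff_mx i (s a i) x by exact: smooth_diff_mx (ss a i) ix.
have dZ a : diff_mx i (fun y => c a *: s a i y) x by exact: diff_mxZ.
have [_ e] := der_mx_sum (index_enum 'I_l) 'i dZ.
rewrite /end01 dzbar_mxE e /lie mulmx_sumr mulmx_suml -sumrB -big_split /=.
apply: eq_bigr => a _; rewrite (der_mxZ _ _ ix (ds a)) dzbar_mxE scalerDr.
by rewrite -scalemxAr -scalemxAl scalerBr.
Qed.

Lemma end10_sum B (l : nat) (c : 'I_l -> R[i]) (s : 'I_l -> coefs X n) i x :
  dom i x -> (forall a, smooth_coefs (s a)) ->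
  end10 1 B (fun i x => \sum_a c a *: s a i x) i x = \sum_a c a *: end10 1 B (s a) i x.
Proof.
move=> ix ss.
have ds a : diff_mx i (s a i) x by exact: smooth_diff_mx (ss a i) ix.
have dZ a : diff_mx i (fun y => c a *: s a i y) x by exact: diff_mxZ.
have [_ e] := der_mx_sum (index_enum 'I_l) (- 'i) dZ.
rewrite /end10 scale1r dz_mxE e /lie mulmx_sumr mulmx_suml -sumrB -big_split /=.
apply: eq_bigr => a _; rewrite (der_mxZ _ _ ix (ds a)) scale1r dz_mxE scalerDr.
by rewrite -scalemxAr -scalemxAl scalerBr.
Qed.

End OperatorAlgebra.

(** * Convergence of families *)

Section SmallPerturbation.
Context {R : realType}.
Implicit Types (V K : set (R * R)) (f : R * R -> R[i]) (mu : R[i]) (w : seq bool).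

Lemma compact_real_bound K (u : R * R -> R) : compact K ->
  (forall p, K p -> {for p, continuous u}) ->
  exists2 B : R, 0 <= B & forall p, K p -> `|u p| <= B.
Proof.
move=> cK cu; have [->|/set0P K0] := eqVneq K set0; first by exists 0.
have cn : {within K, continuous (fun p => `|u p|)}.
  apply: continuous_in_subspaceT => p /set_mem Kp.
  by apply: continuous_comp (cu p Kp) _; exact: norm_continuous.
have [p Kp hp] := compact_EVT_max K0 cK cn.
by exists `|u p| => // q Kq; apply: hp; exact: mem_set.
Qed.

Lemma normc_le (z : R[i]) : `|z| <= (`|complex.Re z| + `|complex.Im z|)%:C.
Proof.
rewrite [z in `|z|]complexE; apply: le_trans (ler_normD _ _) _.
rewrite normrM rmorphD /=; apply: lerD; first by rewrite normc_def /= expr0n addr0 sqrtr_sqr.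
by rewrite !normc_def /= !expr0n /= add0r expr1n sqrtr1 mul1r addr0 sqrtr_sqr.
Qed.

Lemma iter_partialC_bound V K f w : compact K -> K `<=` V -> smooth_on V f ->
  exists2 B : R, 0 <= B & forall p, K p -> `|iter_partialC w f p| <= B%:C.
Proof.
move=> cK KV [s1 s2].
have [B1 B10 h1] := compact_real_bound cK (fun p Kp => (s1 w p (KV p Kp)).1).
have [B2 B20 h2] := compact_real_bound cK (fun p Kp => (s2 w p (KV p Kp)).1).
exists (B1 + B2) => [|p Kp]; first exact: addr_ge0.
apply: le_trans (normc_le _) _; rewrite lecR.
by apply: lerD; [exact: h1|exact: h2].
Qed.

Lemma smooth_on_comb V (N : nat) (c : nat -> R[i]) (f : nat -> R * R -> R[i]) :
  open V -> (forall k, (k < N)%N -> smooth_on V (f k)) ->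
  smooth_on V (fun z => \sum_(0 <= k < N) c k * f k z).
Proof.
move=> oV sf.
have sF k : (0 <= k < N)%N -> smooth_on V (fun z => c k * f k z).
  by move=> /andP[_ kN]; exact: (smooth_onM oV (smooth_on_cst V (c k)) (sf k kN)).
rewrite (_ : (fun z => _) = (fun z =>
    \sum_(k <- index_iota 0 N | (0 <= k < N)%N) c k * f k z)).
  exact: (smooth_on_sum _ oV sF).
by apply/funext => z; rewrite big_nat.
Qed.

Lemma iter_partialC_sum V (N : nat) (c : nat -> R[i]) (f : nat -> R * R -> R[i]) w p :
  open V -> (forall k, (k < N)%N -> smooth_on V (f k)) -> V p ->
  iter_partialC w (fun z => \sum_(0 <= k < N) c k * f k z) p =
  \sum_(0 <= k < N) c k * iter_partialC w (f k) p.
Proof.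
move=> oV + Vp; elim: N => [_|N IH sf].
  rewrite big_nil (_ : (fun z => _) = (fun=> 0)) ?iter_partialC_cst0//.
  by apply/funext => z; rewrite big_nil.
have sS := smooth_on_comb c oV (fun k kN => sf k (leqW kN)).
rewrite (_ : (fun z => _) = (fun z => c N * f N z + \sum_(0 <= k < N) c k * f k z)).
  rewrite (iter_partialC_lin (c N) w oV (sf N (ltnSn N)) sS Vp) IH => [|k kN].
    by rewrite big_nat_recr//= addrC.
  by apply: sf; exact: leqW.
by apply/funext => z; rewrite big_nat_recr//= addrC.
Qed.

(** Every term carries a factor [mu], so for [mu] of modulus at most 1 the derivatives are bounded
    on [K] by the modulus of [mu] times a constant. *)
Lemma near0_perturbation V K (N : nat) (g : R * R -> R[i]) (f : nat -> R * R -> R[i])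
    w (eps : R) : open V -> compact K -> K `<=` V -> 0 < eps ->
  smooth_on V g -> (forall k, (k < N)%N -> smooth_on V (f k)) ->
  \forall mu \near (0 : R[i]^o)^', forall p, K p ->
    `|iter_partialC w (fun z => mu * g z + \sum_(0 <= k < N) mu ^+ k.+1 * f k z) p|
      < eps%:C.
Proof.
move=> oV cK KV eps0 sg sf.
have [B0 B00 hB0] := iter_partialC_bound w cK KV sg.
have /choice[B hB] : forall k, exists B : R, (k < N)%N -> 0 <= B /\
    forall p, K p -> `|iter_partialC w (f k) p| <= B%:C.
  move=> k; have [kN|] := boolP (k < N)%N; last by exists 0.
  by have [B ? ?] := iter_partialC_bound w cK KV (sf k kN); exists B.
(* The added 1 keeps [M] positive, so that eps / M makes sense even when all the bounds vanish. *)
pose M := B0 + \sum_(0 <= k < N) B k + 1.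
have SB0 : 0 <= \sum_(0 <= k < N) B k.
  by rewrite big_nat sumr_ge0// => k /andP[_ /hB[]].
have M0 : 0 < M by rewrite /M ltr_wpDl// addr_ge0.
have e10 : 0 < (Num.min 1 (eps / M))%:C by rewrite ltcR lt_min ltr01 divr_gt0.
have nmu := @dnbhs0_lt _ (R[i]^o) _ e10.
near=> mu => p Kp.
have hmu : `|mu| < (Num.min 1 (eps / M))%:C by near: mu; exact: nmu.
have mu1 : `|mu| <= 1.
  by apply: le_trans (ltW hmu) _; rewrite (_ : (1 : R[i]) = (1 : R)%:C)// lecR ge_min lexx.
have muM : `|mu| * M%:C < eps%:C.
  rewrite -ltr_pdivlMr ?ltcR// -fmorphV -rmorphM.
  by apply: lt_le_trans hmu _; rewrite lecR ge_min lexx orbT.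
have Vp := KV p Kp.
have sS := smooth_on_comb (fun k => mu ^+ k.+1) oV sf.
rewrite (iter_partialC_lin mu w oV sg sS Vp).
rewrite (iter_partialC_sum (fun k => mu ^+ k.+1) w oV sf Vp).
apply: le_lt_trans muM; apply: le_trans (ler_normD _ _) _.
rewrite /M !rmorphD !mulrDr -[X in X <= _]addr0 /=; apply: lerD; last first.
  by rewrite mulr1.
rewrite rmorph_sum mulr_sumr; apply: lerD.
  by rewrite normrM ler_wpM2l// hB0.
apply: le_trans (ler_norm_sum _ _ _) _; rewrite !big_nat; apply: ler_sum => k hk.
rewrite normrM normrX exprS -mulrA ler_wpM2l//.
have [_ /(_ p Kp) hk2] := hB k (andP hk).2; apply: le_trans hk2.
by rewrite ler_piMl// exprn_ile1.
Unshelve. all: by end_near. Qed.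

End SmallPerturbation.

Section FamilyLimit.
Context {R : realType} {X : riemann_surface R} {n : nat} (E : su_bundle X n).

(** Polystability also demands degree 0 of E, regarded as its own unique summand; the flat
    connection (s, t) supplies it. *)
Lemma stable_polystable (A Phi s t : coefs X n) :
  (0 < n)%N -> stable E (LConn 0 A Phi) ->
  is_operator01 E s -> is_operator10 E 1 t ->
  (forall i x, dom i x -> curvature 1 s t i x = 0) ->
  polystable E (LConn 0 A Phi).
Proof.
move=> n_gt0 st os ot F0; exists 1%N, (fun _ _ _ => 1%:M); split.
  split=> [_|i x ix]; first exact: endo_cst.
  split=> [_|a b||_|_].
  - by rewrite mxrank1.
  - by rewrite mulmx1 !ord1 eqxx.
  - by rewrite big_ord1.
  - by rewrite /end01 dzbar_mxE der_mx_cst /lie mulmx1 mul1mx subrr addr0.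
  - by rewrite /end10 dz_mxE der_mx_cst /lie mulmx1 mul1mx subrr scaler0 addr0.
move=> _; split=> //; apply: (flat_degree0 os ot F0) => i x ix.
by rewrite /end10 dz_mxE der_mx_cst /lie mulmx1 mul1mx subrr scaler0 addr0.
Qed.

(** The list and the matrix indices are finite, so the neighbourhoods of [mu] for the separate
    conditions can be intersected. *)
Lemma near_cinf_ball (L : seq (chart X * set (R * R) * seq bool)) (eps : R)
    (c : @lconn R X n) (F : R[i] -> @lconn R X n) (Q : set_system R[i]) :
  Filter Q -> (\forall mu \near Q, `|lam (F mu) - lam c| < eps%:C) ->
  (forall i K w, List.In (i, K, w) L -> forall a b,
    \forall mu \near Q, forall y, K y ->
    `|iter_partialC w (fun z => (c01 (F mu) i (par i z) - c01 c i (par i z)) a b) y|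
      < eps%:C /\
    `|iter_partialC w (fun z => (c10 (F mu) i (par i z) - c10 c i (par i z)) a b) y|
      < eps%:C) ->
  \forall mu \near Q, cinf_ball L eps c (F mu).
Proof.
move=> FQ hl hL; apply: filterI => //.
elim: L hL => [_|[[i K] w] L IH hL]; first by apply: nearW => mu ? ? ? [].
have IHL := IH (fun i K w h => hL i K w (or_intror h)).
have H a b := hL i K w (or_introl erefl) a b.
have {}H : \forall mu \near Q, forall a b y, K y ->
    `|iter_partialC w (fun z => (c01 (F mu) i (par i z) - c01 c i (par i z)) a b) y|
      < eps%:C /\
    `|iter_partialC w (fun z => (c10 (F mu) i (par i z) - c10 c i (par i z)) a b) y|
      < eps%:C.
  apply: filter_forall => a; apply: filter_forall => b; exact: H.
near=> mu => i' K' w' [[<- <- <-]|inL] y a b Ky.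
  by move: a b y Ky; near: mu.
by move: i' K' w' inL y a b Ky; near: mu.
Unshelve. all: by end_near. Qed.

End FamilyLimit.

(** * The family attached to a point of the slice *)

Section SliceFamily.
Context {R : realType} {X : riemann_surface R} {n : nat} (E : su_bundle X n).
Context (l : nat) (P : 'I_l -> coefs X n) (A Phi h beta phi : coefs X n).
Context (VHS : is_stable_VHS E P A Phi) (harm : is_harmonic_metric E P A Phi h).
Context (slice : in_BB_slice E P A Phi h beta phi).
Context (beta_ phi_ : nat -> coefs X n).
Context (beta_j : forall j, (1 <= j <= l)%N ->
  is_form01 E (beta_ j) /\ in_sl P (pred1 j%:Z) (beta_ j)).
Context (phi_j : forall j, (j <= l)%N ->
  is_form10 E (phi_ j) /\ in_sl P (pred1 j%:Z) (phi_ j)).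
Context (beta_sum : forall i x, dom i x -> beta i x = \sum_(1 <= j < l.+1) beta_ j i x).
Context (phi_sum : forall i x, dom i x -> phi i x = \sum_(0 <= j < l.+1) phi_ j i x).
Context (l_gt0 : (0 < l)%N).
Implicit Types (i : chart X) (x : X) (lambda mu nu : R[i]).

Local Notation H := (chern10 A h).
Local Notation Phi_adj := (adj_h h Phi).
Local Notation nabla := (slice_connection A Phi h beta phi).

Let metric_h : is_metric E h. Proof. by case: harm. Qed.
Let opA : is_operator01 E A. Proof. by case: VHS => -[]. Qed.
Let formPhi : is_form10 E Phi.
Proof. by apply: operator10_0; case: VHS => -[]. Qed.
Let form_adj : is_form01 E Phi_adj. Proof. exact: adj_h_form01. Qed.
Let opH : is_operator10 E 1 H. Proof. exact: chern10_law. Qed.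
Let sA : smooth_coefs A. Proof. by case: opA. Qed.
Let sH : smooth_coefs H. Proof. by case: opH. Qed.
Let trA i x : dom i x -> \tr (A i x) = 0.
Proof. by move=> ix; case: VHS => -[_ _ /(_ i x ix)[]]. Qed.
Let trPhi i x : dom i x -> \tr (Phi i x) = 0.
Proof. by move=> ix; case: VHS => -[_ _ /(_ i x ix)[]]. Qed.
Let trH i x : dom i x -> \tr (H i x) = 0.
Proof. by move=> ix; apply: (mxtrace_chern10 metric_h ix); exact: trA. Qed.
Let tr_adj i x : dom i x -> \tr (Phi_adj i x) = 0.
Proof.
by move=> ix; apply: (mxtrace_adj_h metric_h ix); exact: trPhi.
Qed.
Let dbarPhi i x : dom i x -> end01 A Phi i x = 0.
Proof.
move=> ix; case: VHS => -[_ _ _ /(_ i x ix)].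
by rewrite /curvature scale0r subr0.
Qed.

Let endoP a : is_endo E (P a). Proof. by case: VHS => _ _ _ []. Qed.
Let orthP i x : dom i x -> forall a b, P a i x *m P b i x = if a == b then P a i x else 0.
Proof. by move=> ix; case: VHS => _ _ _ [_ /(_ i x ix)[]]. Qed.
Let sumP i x : dom i x -> \sum_a P a i x = 1%:M.
Proof. by move=> ix; case: VHS => _ _ _ [_ /(_ i x ix)[]]. Qed.
Let dbarP a i x : dom i x -> end01 A (P a) i x = 0.
Proof. by move=> ix; case: VHS => _ _ _ [_ /(_ i x ix)[]]. Qed.
Let lowerPhi i x (a b : 'I_l) : dom i x -> (b : nat) != a.+1 ->
  P b i x *m Phi i x *m P a i x = 0.
Proof. by move=> ix; case: VHS => _ _ _ _ /(_ i x ix a b). Qed.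

(** Inserting the sum of the projectors on either side leaves, by orthogonality, the same middle
    block of [h] in both products. *)
Lemma splitting_self_adjoint a i x : dom i x ->
  h i x *m P a i x = (P a i x)^t* *m h i x.
Proof.
move=> ix; have [_ _ hP] := harm.
transitivity ((P a i x)^t* *m h i x *m P a i x).
  rewrite -[LHS]mul1mx -[1%:M]ctrK (_ : 1%:M^t* = \sum_b P b i x); last first.
    by rewrite sumP// tr_scalar_mx map_mx1.
  have -> : (\sum_b P b i x)^t* = \sum_b (P b i x)^t*.
    by apply: (big_morph (fun M : 'M[_]_n => M^t*)) => [M N|]; rewrite ?ctrD ?ctr0.
  rewrite mulmx_suml (bigD1 a)//= [X in _ + X]big1 ?addr0 ?mulmxA// => b ba.
  by rewrite mulmxA hP.
rewrite -[RHS]mulmx1 -(sumP ix) mulmx_sumr (bigD1 a)//= [X in _ + X]big1 ?addr0//.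
by move=> b ba; rewrite hP// eq_sym.
Qed.

Lemma adj_splitting a i x : dom i x -> adj_h h (P a) i x = P a i x.
Proof. by move=> ix; apply: (adj_h_eq metric_h ix); exact: splitting_self_adjoint. Qed.

(** [P a] is its own adjoint, so its del^h-derivative is the adjoint of its dbar-derivative, which
    is 0. *)
Lemma chern10_splitting a i x : dom i x -> end10 1 H (P a) i x = 0.
Proof.
move=> ix; have [sPa _] := endoP a.
have e := end10_adj_h A metric_h sPa ix.
transitivity (end10 1 H (adj_h h (P a)) i x).
  rewrite /end10 !dz_mxE (adj_splitting a ix).
  by rewrite (eq_der_mx _ (@rs_dom_open _ X i) ix ix (fun y iy => adj_splitting a iy)).
by rewrite e adj_h_eq0// dbarP.
Qed.

(** Multiplied by [h], the block is the adjoint of the opposite block of [Phi]. Hence the adjoint of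
    [Phi] has degree 1. *)
Lemma raise_adj_Phi i x (a b : 'I_l) : dom i x -> (a : nat) != (b + 1)%N ->
  P b i x *m Phi_adj i x *m P a i x = 0.
Proof.
move=> ix ab; rewrite -[LHS](mulKmx (metric_unit metric_h ix)).
have -> : h i x *m (P b i x *m Phi_adj i x *m P a i x) =
    (P a i x *m Phi i x *m P b i x)^t* *m h i x.
  move: (Phi_adj i x) (mul_adj_h Phi metric_h ix) => Q hQ.
  rewrite !mulmxA (splitting_self_adjoint b ix) -[_ *m h i x *m Q]mulmxA hQ.
  rewrite !mulmxA -[_ *m h i x *m P a i x]mulmxA.
  by rewrite (splitting_self_adjoint a ix) !ctrM !mulmxA.
by rewrite (lowerPhi ix) ?ctr0 ?mul0mx ?mulmx0// -addn1.
Qed.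

Lemma chern10_adj_Phi i x : dom i x -> end10 1 H Phi_adj i x = 0.
Proof.
move=> ix; have [sPhi _] := formPhi.
by rewrite (end10_adj_h A metric_h sPhi ix) adj_h_eq0// dbarPhi.
Qed.

(** This is Hitchin's equation: when the flatness of the harmonic connection is expanded, dbar Phi
    and the del^h-derivative of its adjoint both vanish. *)
Lemma curvature_unitary i x : dom i x ->
  curvature 1 A H i x = - lie (Phi_adj i x) (Phi i x).
Proof.
move=> ix; have [_ /(_ i x ix) F _] := harm.
have [sPhi _] := formPhi; have [sadj _] := form_adj.
move: F; rewrite (curvature_expand ix sA sH sadj sPhi) dbarPhi// chern10_adj_Phi//.
by rewrite subr0 addr0 => /eqP; rewrite addr_eq0 => /eqP.
Qed.

(** The slice equations turn the derivative terms into commutators, Hitchin's equation does the same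
    for the curvature of dbar + del^h, and all commutators cancel. *)
Lemma slice_flat i x : dom i x -> curvature 1 (c01 nabla) (c10 nabla) i x = 0.
Proof.
move=> ix; have [[[sb _] _] [[sp _] _] e1 e2] := slice.
have [sPhi _] := formPhi; have [sadj _] := form_adj.
have sa : smooth_coefs (fun i x => Phi_adj i x + beta i x) by move=> k; exact: smooth_mxD.
have sps : smooth_coefs (fun i x => Phi i x + phi i x) by move=> k; exact: smooth_mxD.
rewrite (@eq_curvature _ _ _ 1 _ _ (fun i x => A i x + (Phi_adj i x + beta i x))
  (fun i x => H i x + (Phi i x + phi i x)) _ _ ix); first last.
- by move=> y _; rewrite /= addrA.
- by move=> y _; rewrite /= addrA.
rewrite (curvature_expand ix sA sH sa sps) (curvature_unitary ix).
have [sd1 sd2] : diff_mx i (Phi i) x /\ diff_mx i (phi i) x.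
  by split; [exact: smooth_diff_mx (sPhi i) ix|exact: smooth_diff_mx (sp i) ix].
have [sd3 sd4] : diff_mx i (Phi_adj i) x /\ diff_mx i (beta i) x.
  by split; [exact: smooth_diff_mx (sadj i) ix|exact: smooth_diff_mx (sb i) ix].
have -> : end01 A (fun i x => Phi i x + phi i x) i x = lie (Phi i x + phi i x) (beta i x).
  have /eqP := e1 i x ix; rewrite subr_eq0 => /eqP <-.
  rewrite -[RHS]add0r -(dbarPhi ix) /end01 !dzbar_mxE (der_mxD _ sd1 sd2) /lie.
  rewrite mulmxDl mulmxDr.
  move: (der_mx _ i (Phi i) x) (der_mx _ i (phi i) x) => D1 D2.
  by mx_linear.
have -> : end10 1 H (fun i x => Phi_adj i x + beta i x) i x =
    lie (Phi_adj i x) (phi i x).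
  have /eqP := e2 i x ix; rewrite subr_eq0 => /eqP <-.
  rewrite -[RHS]add0r -(chern10_adj_Phi ix) /end10 !dz_mxE (der_mxD _ sd3 sd4) /lie.
  rewrite mulmxDl mulmxDr !scale1r.
  move: (der_mx _ i (Phi_adj i) x) (der_mx _ i (beta i) x) => D1 D2.
  by mx_linear.
rewrite /lie !(mulmxDl, mulmxDr).
by mx_linear.
Qed.

(** * The lambda-connections of the section and the family *)

Definition slice_lconn mu : @lconn R X n :=
  LConn mu (c01 nabla) (fun i x => mu *: c10 nabla i x).

Lemma is_lconn_slice mu : is_lconn E (slice_lconn mu).
Proof.
have [[formb slb] [formp slp] _ _] := slice.
have op01 : is_operator01 E (c01 nabla).
  by apply: operator01D formb; exact: operator01D.
have op10 : is_operator10 E 1 (c10 nabla).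
  by apply: operator10D formp; exact: operator10D.
split; [exact: op01|exact: operator10Z| |].
  move=> i x ix; rewrite /= mxtraceZ !mxtraceD trA// tr_adj// trH// trPhi//.
  by rewrite (slb i x ix).1 (slp i x ix).1 !addr0 mulr0.
move=> i x ix; have [s10 _] := op10.
by rewrite [LHS](curvatureZ _ _ ix s10) slice_flat// scaler0.
Qed.

Definition family lambda : @lconn R X n :=
  LConn lambda
    (fun i x => A i x + lambda *: (Phi_adj i x + beta_ 1%N i x)
                + \sum_(2 <= j < l.+1) lambda ^+ j *: beta_ j i x)
    (fun i x => Phi i x + lambda *: H i x
                + \sum_(0 <= j < l.+1) lambda ^+ j.+1 *: phi_ j i x).

Lemma family0 : family 0 = LConn 0 A Phi.
Proof.
rewrite /family; congr LConn; apply/funext => i; apply/funext => x.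
  rewrite scale0r addr0 big_nat big1 ?addr0// => j /andP[j2 _].
  by rewrite expr0n gtn_eqF ?scale0r// ltnW.
rewrite scale0r addr0 big1 ?addr0// => j _.
by rewrite expr0n scale0r.
Qed.

(** Together with [family10], the tensorial part of the family, left after removing dbar and lambda
    del^h. Conjugation by a parallel gauge transformation only affects this part. *)
Definition family01 lambda : coefs X n :=
  fun i x => lambda *: Phi_adj i x + \sum_(1 <= j < l.+1) lambda ^+ j *: beta_ j i x.

Definition family10 lambda : coefs X n :=
  fun i x => Phi i x + \sum_(0 <= j < l.+1) lambda ^+ j.+1 *: phi_ j i x.

Lemma c01_familyE lambda i x : c01 (family lambda) i x = A i x + family01 lambda i x.
Proof.
(* Splitting off the term j = 1 uses [0 < l]. *)
by rewrite /= /family01 [in RHS]big_ltn ?ltnS// expr1 scalerDr !addrA.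
Qed.

Lemma c10_familyE lambda i x :
  c10 (family lambda) i x = lambda *: H i x + family10 lambda i x.
Proof. by rewrite /= /family10 [Phi i x + lambda *: _]addrC addrA. Qed.

Lemma form01_family lambda : is_form01 E (family01 lambda).
Proof.
apply: form01_lin form_adj _.
by apply: (@form01_sum _ _ _ E 1 l.+1 (fun j => lambda ^+ j)) => j; rewrite ltnS => /beta_j[].
Qed.

Lemma form10_family lambda : is_form10 E (family10 lambda).
Proof.
have sum_form : is_form10 E (fun i x => \sum_(0 <= j < l.+1) lambda ^+ j.+1 *: phi_ j i x).
  apply: (@form10_sum _ _ _ E 0 l.+1 (fun j => lambda ^+ j.+1)) => j; rewrite ltnS.
  by move=> /andP[_ /phi_j[]].
rewrite (_ : family10 lambda = fun i x =>
    1 *: Phi i x + \sum_(0 <= j < l.+1) lambda ^+ j.+1 *: phi_ j i x).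
  exact: form10_lin.
by apply/funext => i; apply/funext => x; rewrite scale1r.
Qed.

Lemma mxtrace_family lambda i x : dom i x ->
  \tr (c01 (family lambda) i x) = 0 /\ \tr (c10 (family lambda) i x) = 0.
Proof.
move=> ix; rewrite c01_familyE c10_familyE /family01 /family10 !mxtraceD !mxtraceZ.
rewrite trA// tr_adj// trH// trPhi// !mulr0 !add0r !raddf_sum /= !big_nat.
split; apply: big1 => j; rewrite ltnS => hj; rewrite mxtraceZ.
  by have [_ /(_ i x ix)[-> _]] := beta_j hj; rewrite mulr0.
by have [_ /(_ i x ix)[-> _]] := phi_j (andP hj).2; rewrite mulr0.
Qed.

(** * The gauge transformation built from the weights *)

Definition weight_gauge c nu : coefs X n :=
  fun i x => \sum_(a < l) (c * nu ^+ a) *: P a i x.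

Lemma weight_gaugeE c nu i x :
  weight_gauge c nu i x = c *: weight (fun a => P a i x) nu.
Proof. by rewrite /weight scaler_sumr; apply: eq_bigr => a _; rewrite scalerA. Qed.

Lemma endo_weight_gauge c nu : is_endo E (weight_gauge c nu).
Proof.
split=> [i|i j x ix jx].
  by apply: smooth_mx_sum => a _; apply: smooth_mxZ; have [sPa _] := endoP a.
rewrite mulmx_suml mulmx_sumr; apply: eq_bigr => a _.
by have [_ lPa] := endoP a; rewrite -scalemxAl -scalemxAr (lPa i j x ix jx).
Qed.

Lemma end01_weight_gauge c nu i x : dom i x -> end01 A (weight_gauge c nu) i x = 0.
Proof.
move=> ix; rewrite (end01_sum A (fun a : 'I_l => c * nu ^+ a) ix) => [|a].
  by apply: big1 => a _; rewrite dbarP// scaler0.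
by have [] := endoP a.
Qed.

Lemma end10_weight_gauge c nu i x : dom i x -> end10 1 H (weight_gauge c nu) i x = 0.
Proof.
move=> ix; rewrite (end10_sum H (fun a : 'I_l => c * nu ^+ a) ix) => [|a].
  by apply: big1 => a _; rewrite chern10_splitting// scaler0.
by have [] := endoP a.
Qed.

(** It is applied with [nu] the inverse of lambda, so that conjugation multiplies degree k by
    lambda^k. *)
Lemma weight_gauge_raise (k : nat) psi c nu i x : nu != 0 -> dom i x ->
  (forall a b : 'I_l, (a : nat) != (b + k)%N -> P b i x *m psi *m P a i x = 0) ->
  weight_gauge c nu i x *m psi = nu^-1 ^+ k *: (psi *m weight_gauge c nu i x).
Proof.
move=> nu0 ix hpsi; rewrite weight_gaugeE -scalemxAl -scalemxAr.
rewrite (weight_raise (orthP ix) (sumP ix) nu hpsi).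
rewrite [nu^-1 ^+ k *: _]scalerA [_ * c]mulrC -scalerA; congr (_ *: _).
by rewrite scalerA -exprMn mulVf// expr1n scale1r.
Qed.

Lemma weight_gauge_lower c nu i x : dom i x ->
  weight_gauge c nu i x *m Phi i x = nu *: (Phi i x *m weight_gauge c nu i x).
Proof.
move=> ix; rewrite weight_gaugeE -scalemxAl -scalemxAr.
rewrite (weight_lower (orthP ix) (sumP ix)) => [|a b]; last exact: lowerPhi.
by rewrite scalerA mulrC -scalerA.
Qed.

Lemma in_sl_raise (k : nat) psi i x (a b : 'I_l) : in_sl P (pred1 k%:Z) psi ->
  dom i x -> (a : nat) != (b + k)%N -> P b i x *m psi i x *m P a i x = 0.
Proof.
move=> sl ix ab; have [_] := sl i x ix; apply=> /=.
by rewrite subr_eq -PoszD addnC eqz_nat.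
Qed.

Lemma weight_gauge01 lambda c i x : lambda != 0 -> dom i x ->
  weight_gauge c lambda^-1 i x *m (Phi_adj i x + beta i x) =
  family01 lambda i x *m weight_gauge c lambda^-1 i x.
Proof.
move=> l0 ix; have lV0 : lambda^-1 != 0 by rewrite invr_eq0.
rewrite mulmxDr /family01 mulmxDl; congr (_ + _).
  rewrite (weight_gauge_raise (k := 1) _ lV0 ix) ?invrK -?scalemxAl// => a b.
  exact: raise_adj_Phi.
rewrite beta_sum// mulmx_sumr mulmx_suml !big_nat; apply: eq_bigr => j hj.
have [_ sl] := beta_j hj.
rewrite (weight_gauge_raise (k := j) _ lV0 ix) ?invrK -?scalemxAl// => a b.
exact: in_sl_raise.
Qed.

(** The factor lambda in front of D is cancelled on [Phi], which has degree -1, and raises the power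
    on [phi_ j] to j + 1. *)
Lemma weight_gauge10 lambda c i x : lambda != 0 -> dom i x ->
  lambda *: (weight_gauge c lambda^-1 i x *m (Phi i x + phi i x)) =
  family10 lambda i x *m weight_gauge c lambda^-1 i x.
Proof.
move=> l0 ix; have lV0 : lambda^-1 != 0 by rewrite invr_eq0.
rewrite mulmxDr /family10 mulmxDl scalerDr; congr (_ + _).
  by rewrite (weight_gauge_lower c _ ix) scalerA divff// scale1r.
rewrite phi_sum// mulmx_sumr mulmx_suml scaler_sumr !big_nat; apply: eq_bigr => j hj.
have [_ sl] := phi_j (andP hj).2.
rewrite (weight_gauge_raise (k := j) _ lV0 ix) ?invrK => [|a b].
  by rewrite scalerA -exprS scalemxAl.
exact: in_sl_raise.
Qed.

(** The curvature is a commutator of matrices of degrees 1 and -1, hence has degree 0. *)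
Lemma weight_gauge_curvature c nu i x : nu != 0 -> dom i x ->
  weight_gauge c nu i x *m curvature 1 A H i x =
  curvature 1 A H i x *m weight_gauge c nu i x.
Proof.
move=> nu0 ix; rewrite curvature_unitary// mulmxN mulNmx; congr (- _).
have e1 : weight_gauge c nu i x *m Phi_adj i x =
    nu^-1 *: (Phi_adj i x *m weight_gauge c nu i x).
  by rewrite (weight_gauge_raise (k := 1) _ nu0 ix)// => a b; exact: raise_adj_Phi.
have e2 := weight_gauge_lower c nu ix.
move: (Phi_adj i x) e1 => Q e1.
rewrite /lie mulmxBr mulmxBl !mulmxA e1 e2 -!scalemxAl -!mulmxA e1 e2.
by rewrite -!scalemxAr !scalerA divff// mulVf// !scale1r.
Qed.

(** The determinant of the unnormalised sum is parallel, hence equal everywhere to its value [D] at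
    the base point; scaling by [c] multiplies it by c^n. *)
Lemma weight_gauge_det (i0 : chart X) (x0 : X) nu : (0 < n)%N -> dom i0 x0 -> nu != 0 ->
  exists c, forall i x, dom i x -> \det (weight_gauge c nu i x) = 1.
Proof.
move=> n_gt0 ix0 nu0; set D := \det (weight_gauge 1 nu i0 x0).
have D0 : D != 0.
  have := congr1 (fun M : 'M[_]_n => \det M) (weightV (orthP ix0) (sumP ix0) nu0).
  rewrite /= det_mulmx det1 => e; apply/eqP => D0; move: e.
  rewrite (_ : \det (weight _ nu) = D); first by rewrite D0 mul0r => /esym/eqP; rewrite oner_eq0.
  by rewrite /D weight_gaugeE scale1r.
exists (n.-root D^-1) => i x ix.
rewrite weight_gaugeE detZ rootCK//.
have -> : \det (weight (fun a => P a i x) nu) = D.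
  rewrite /D -[weight _ _]scale1r -weight_gaugeE.
  apply: (parallel_det_cst (endo_weight_gauge 1 nu) _ _ ix ix0).
    by move=> *; exact: end01_weight_gauge.
  by move=> *; exact: end10_weight_gauge.
by rewrite mulVf.
Qed.

Section Gauged.
Context (lambda c : R[i]) (lambda0 : lambda != 0).
Context (detg : forall i x, dom i x -> \det (weight_gauge c lambda^-1 i x) = 1).
Local Notation g := (weight_gauge c lambda^-1).

Lemma gauge_by_family : gauge_by E g (slice_lconn lambda) (family lambda).
Proof.
split; [by []|exact: endo_weight_gauge|exact: detg|].
move=> i x ix; rewrite c01_familyE c10_familyE scale1r.
(* Since [g] is parallel, its derivatives become commutators with [A] and [H]; these absorb dbar and
   lambda del^h, leaving only the tensorial parts to compare. *)
have := end01_weight_gauge c lambda^-1 ix.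
rewrite /end01 dzbar_mxE => /eqP; rewrite addr_eq0 => /eqP ->.
have := end10_weight_gauge c lambda^-1 ix.
rewrite /end10 scale1r dz_mxE => /eqP; rewrite addr_eq0 => /eqP ->.
have -> : c01 (slice_lconn lambda) i x = A i x + (Phi_adj i x + beta i x).
  by rewrite /= addrA.
have -> : c10 (slice_lconn lambda) i x = lambda *: (H i x + (Phi i x + phi i x)).
  by rewrite /= addrA.
split.
  rewrite [LHS]mulmxDl -(weight_gauge01 c lambda0 ix) [g i x *m (A i x + _)]mulmxDr /lie.
  by mx_linear.
rewrite -[lam (slice_lconn lambda)]/lambda.
rewrite [LHS]mulmxDl -(weight_gauge10 c lambda0 ix) -scalemxAl.
rewrite -[g i x *m (lambda *: _)]scalemxAr [g i x *m (H i x + _)]mulmxDr /lie.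
by mx_linear.
Qed.

(** The gluing laws and traces are read off the formula. Flatness comes from writing the family as
    dbar and lambda del^h plus conjugates of the tensorial parts of the slice connection. *)
Lemma is_lconn_family : is_lconn E (family lambda).
Proof.
have [[[sb _] _] [[sp _] _] _ _] := slice.
have [sPhi _] := formPhi; have [sadj _] := form_adj.
split.
- by apply: eq_operator01 (operator01D opA (form01_family lambda)) => i x _;
    rewrite c01_familyE.
- by apply: eq_operator10 (operator10D (operator10Z lambda opH) (form10_family lambda))
    => i x _; rewrite c10_familyE.
- by move=> i x ix; exact: mxtrace_family.
move=> i x ix.
pose alpha : coefs X n := fun i x => Phi_adj i x + beta i x.
pose psi : coefs X n := fun i x => Phi i x + phi i x.
have sa : smooth_coefs alpha by move=> k; exact: smooth_mxD.
have sps : smooth_coefs psi by move=> k; exact: smooth_mxD.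
have eg := endo_weight_gauge c lambda^-1.
have sg : smooth_coefs g by case: eg.
have sk : smooth_coefs (fun i x => invmx (g i x)) by case: (endo_inv eg detg).
have sB : smooth_coefs (fun i x => H i x + conj_by g psi i x).
  move=> k; apply: smooth_mxD (sH k) _.
  by apply: smooth_mxM (sk k); exact: smooth_mxM.
have flat : curvature 1 (fun i x => A i x + alpha i x) (fun i x => H i x + psi i x) i x = 0.
  rewrite -(slice_flat ix); apply: eq_curvature => // y _; rewrite /= /alpha /psi addrA//.
rewrite (@eq_curvature _ _ _ lambda _ _ (fun i x => A i x + conj_by g alpha i x)
  (fun i x => lambda *: (H i x + conj_by g psi i x)) _ _ ix).
- rewrite (curvatureZ _ _ ix sB).
  have lV0 : lambda^-1 != 0 by rewrite invr_eq0.
  have Fc := curvature_conj eg detg sA sH sa sps (@end01_weight_gauge c lambda^-1)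
    (@end10_weight_gauge c lambda^-1) ix (weight_gauge_curvature c lV0 ix) flat.
  by rewrite Fc scaler0.
- move=> y iy; rewrite c01_familyE /conj_by /alpha weight_gauge01//.
  by rewrite -mulmxA (det1_mulmxV (detg iy)) mulmx1.
- move=> y iy; rewrite c10_familyE /conj_by /psi scalerDr scalemxAl weight_gauge10//.
  by rewrite -mulmxA (det1_mulmxV (detg iy)) mulmx1.
Qed.

End Gauged.

(** The differences of the coefficients of [family mu] and [family 0] are polynomials in [mu]
    without constant term. *)
Lemma near_family (L : seq (chart X * set (R * R) * seq bool)) (eps : R) :
  compacts_in_charts L -> 0 < eps ->
  \forall mu \near (0 : R[i]^o)^', cinf_ball L eps (family 0) (family mu).
Proof.
move=> hL eps0; apply: near_cinf_ball.
  have epsC : 0 < eps%:C by rewrite ltcR.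
  have := @dnbhs0_lt _ (R[i]^o) _ epsC; apply: filterS => mu /=.
  by rewrite subr0.
move=> i K w inL a b; have [cK KV] := hL i K w inL.
have oV : open (crd i @` dom i) by exact: rs_img_open.
have [sadj _] := form_adj.
(* [beta_] is numbered from 1 and has coefficient mu^j, [phi_] from 0 with mu^(j+1): hence the shift
   here and the different lengths. *)
have near01 := near0_perturbation (N := l) (g := fun z => Phi_adj i (par i z) a b)
  (f := fun k z => beta_ k.+1 i (par i z) a b) w oV cK KV eps0 (sadj i a b)
  (fun k (kl : (k < l)%N) => (@beta_j k.+1 kl).1.1 i a b).
have near10 := near0_perturbation (N := l.+1) (g := fun z => H i (par i z) a b)
  (f := fun k z => phi_ k i (par i z) a b) w oV cK KV eps0 (sH i a b)
  (fun k (kl : (k < l.+1)%N) => (@phi_j k kl).1.1 i a b).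
near=> mu => y Ky; rewrite family0.
have e01 : (fun z => (c01 (family mu) i (par i z) - c01 (LConn 0 A Phi) i (par i z)) a b) =
    (fun z => mu * Phi_adj i (par i z) a b +
      \sum_(0 <= k < l) mu ^+ k.+1 * beta_ k.+1 i (par i z) a b).
  apply/funext => z; rewrite c01_familyE /= addrC addKr /family01 big_add1 /=.
  rewrite mxE summxE mxE; congr (_ + _).
  by apply: eq_bigr => k _; rewrite mxE.
have e10 : (fun z => (c10 (family mu) i (par i z) - c10 (LConn 0 A Phi) i (par i z)) a b) =
    (fun z => mu * H i (par i z) a b +
      \sum_(0 <= k < l.+1) mu ^+ k.+1 * phi_ k i (par i z) a b).
  apply/funext => z.
  have -> : c10 (family mu) i (par i z) - Phi i (par i z) = mu *: H i (par i z) +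
      \sum_(0 <= k < l.+1) mu ^+ k.+1 *: phi_ k i (par i z).
    rewrite c10_familyE; apply/eqP; rewrite subr_eq -addrA; apply/eqP.
    by congr (_ + _); exact: addrC.
  rewrite mxE summxE mxE; congr (_ + _).
  by apply: eq_bigr => k _; rewrite mxE.
by rewrite e01 e10; split; move: y Ky; near: mu.
Unshelve. all: by end_near. Qed.

(** * Polystability of the family and the section it defines *)

Context (n_gt0 : (0 < n)%N) (i0 : chart X) (x0 : X) (ix0 : dom i0 x0).
Context (nabla_reductive : reductive E nabla).

(** Multiplying D by a nonzero scalar changes neither the parallel projectors nor the invariant
    subbundles. *)
Lemma split_irreducible_slice mu : mu != 0 -> split_irreducible E (slice_lconn mu).
Proof.
move=> mu0; have [_ [m [p [[ep dp] irr]]]] := nabla_reductive.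
have lieZ (B M : 'M[R[i]]_n) : lie (mu *: B) M = mu *: lie B M.
  by rewrite /lie -scalemxAl -scalemxAr scalerBr.
exists m, p; split.
  split=> [|i x ix]; first exact: ep.
  have [rk orth sum d1 d2] := dp i x ix.
  split; [exact: rk|exact: orth|exact: sum|exact: d1|move=> a].
  have := d2 a; rewrite /end10 scale1r => e.
  by rewrite /= lieZ -scalerDr e scaler0.
move=> a q [prq inv_q]; apply: (irr a q); split=> [|i x ix]; first exact: prq.
have [h1 h2] := inv_q i x ix; split; first exact: h1.
by apply: (scalerI mu0); rewrite scaler0 -h2 /= scale1r -scalemxAl -scalerDr -scalemxAr.
Qed.

Lemma slice_polystable mu : mu != 0 -> polystable E (slice_lconn mu).
Proof.
move=> mu0.
exact: split_irreducible_polystable (is_lconn_slice mu) mu0 (split_irreducible_slice mu0).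
Qed.

Lemma gauge_family lambda : lambda != 0 ->
  exists g, gauge_by E g (slice_lconn lambda) (family lambda).
Proof.
move=> l0; have lV0 : lambda^-1 != 0 by rewrite invr_eq0.
have [c dc] := weight_gauge_det n_gt0 ix0 lV0.
by exists (weight_gauge c lambda^-1); exact: gauge_by_family.
Qed.

Lemma family_polystable lambda :
  is_lconn E (family lambda) /\ polystable E (family lambda).
Proof.
have [->|l0] := eqVneq lambda 0.
  rewrite family0; have [lc st _ _ _] := VHS; split; first exact: lc.
  (* The slice connection itself is the flat connection showing that E has degree 0. *)
  have [oA oB _ _] := is_lconn_slice 1.
  apply: (stable_polystable n_gt0 st oA oB) => i x ix.
  by have [_ _ _ /(_ i x ix)] := is_lconn_slice 1.
have lV0 : lambda^-1 != 0 by rewrite invr_eq0.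
have [c dc] := weight_gauge_det n_gt0 ix0 lV0.
have lc := is_lconn_family l0 dc; split; first exact: lc.
have irr := split_irreducible_gauge (gauge_by_family l0 dc) (split_irreducible_slice l0).
exact: split_irreducible_polystable lc l0 irr.
Qed.

Definition family_section lambda : MHod E :=
  hod_class (exist _ (family lambda) (family_polystable lambda)).

Lemma family_section_slice mu : mu != 0 -> hod_point (family_section mu) (slice_lconn mu).
Proof.
move=> mu0; exists (conj (is_lconn_slice mu) (slice_polystable mu0)).
apply/esym/eq_hod_class/gauge_equivP => /=; exact: gauge_family.
Qed.

(** Open sets of the quotient are those with open preimage, so convergence of the representatives in
    the C^infinity balls suffices. *)
Lemma family_section_cvg :
  family_section mu @[mu --> (0 : R[i]^o)^'] --> family_section 0.
Proof.
move=> W; rewrite nbhsE => -[U [oU U0] UW].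
have {}oU : hod_open U by exact: oU.
have [L [eps [hL eps0 hU]]] := oU _ U0.
have := near_family hL eps0; apply: filterS => mu hmu /=.
by apply: UW; exact: (hU (exist _ (family mu) (family_polystable mu)) hmu).
Qed.

End SliceFamily.

(** * Base point, existence and uniqueness of the section *)

Lemma genus_nonempty (R : realType) (X : riemann_surface R) (g : nat) :
  genus_ge X g.+1 -> exists x : X, True.
Proof.
move=> [w [_ indep]]; apply: contrapT => nX.
(* On an empty surface every linear relation holds vacuously, even the one with all coefficients
   1. *)
have /eqP := indep (fun=> 1) (fun i x _ => False_ind _ (nX (ex_intro _ x I))) ord0.
by rewrite oner_eq0.
Qed.

Theorem proposition5p5 (R : realType) (X : riemann_surface R)
    (X_compact : compact [set: X]) (X_genus : genus_ge X 2)
    (n : nat) (n_gt0 : (0 < n)%N) (E : su_bundle X n)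
    (l : nat) (P : 'I_l -> coefs X n) (A Phi h : coefs X n)
    (VHS : is_stable_VHS E P A Phi)
    (h_harmonic : is_harmonic_metric E P A Phi h)
    (beta phi : coefs X n)
    (slice : in_BB_slice E P A Phi h beta phi)
    (* Collier--Wentworth: the flat connection is irreducible; in particular it
       is reductive, which is what the definition of s_nabla requires *)
    (nabla_reductive : reductive E (slice_connection A Phi h beta phi))
    (beta_ phi_ : nat -> coefs X n)
    (beta_j : forall j, (1 <= j <= l)%N ->
       is_form01 E (beta_ j) /\ in_sl P (pred1 j%:Z) (beta_ j))
    (phi_j : forall j, (j <= l)%N ->
       is_form10 E (phi_ j) /\ in_sl P (pred1 j%:Z) (phi_ j))
    (beta_sum : forall i x, dom i x ->
       beta i x = \sum_(1 <= j < l.+1) beta_ j i x)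
    (phi_sum : forall i x, dom i x ->
       phi i x = \sum_(0 <= j < l.+1) phi_ j i x) :
  exists s : R[i] -> MHod E,
    [/\ is_nabla_section (slice_connection A Phi h beta phi) s,
        forall lambda : R[i],
          hod_point (s lambda)
            (LConn lambda
               (fun i x => A i x + lambda *: (adj_h h Phi i x + beta_ 1%N i x)
                           + \sum_(2 <= j < l.+1) lambda ^+ j *: beta_ j i x)
               (fun i x => Phi i x + lambda *: chern10 A h i x
                           + \sum_(0 <= j < l.+1) lambda ^+ j.+1 *: phi_ j i x))
      & hausdorff_space (MHod E) ->
        forall s', is_nabla_section (slice_connection A Phi h beta phi) s' ->
          s' = s].
Proof.
have [x0 _] := genus_nonempty X_genus; have [i0 ix0] := rs_cover x0.
(* With l = 0 the identity would be an empty sum of projectors, forcing its rank [n] to be 0. *)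
have l_gt0 : (0 < l)%N.
  have [_ _ _ [_ /(_ i0 x0 ix0)[_ _ sumP _]] _] := VHS.
  case: l P sumP {VHS h_harmonic slice beta_j phi_j beta_sum phi_sum} => // P0 sumP0.
  have := congr1 (fun M : 'M[R[i]]_n => \rank M) sumP0.
  by rewrite big_ord0 mxrank0 mxrank1 => n0; rewrite -n0 in n_gt0.
pose s := family_section VHS h_harmonic slice beta_j phi_j beta_sum phi_sum l_gt0
  n_gt0 ix0 nabla_reductive.
have s_slice (mu : R[i]) : mu != 0 ->
    hod_point (s mu) (slice_lconn A Phi h beta phi mu).
  exact: family_section_slice.
have s_cvg : s mu @[mu --> (0 : R[i]^o)^'] --> s 0 by exact: family_section_cvg.
exists s; split.
- by split; [exact: s_slice|exact: s_cvg].
- move=> lambda; eexists; reflexivity.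
move=> hE s' [s'_slice s'_cvg].
(* Away from 0 the value is a prescribed class, up to the proof that its representative is
   polystable; the value at 0 is then a limit, unique in a Hausdorff space. *)
have e mu : mu != 0 -> s' mu = s mu.
  move=> mu0; have [H1 ->] := s'_slice mu mu0; have [H2 e2] := s_slice mu mu0.
  by rewrite e2 (Prop_irrelevance H1 H2).
apply/funext => mu; have [->|/e//] := eqVneq mu 0.
apply: (cvg_unique hE) s_cvg.
apply: cvg_trans s'_cvg; apply: near_eq_cvg.
have := @nbhs_dnbhs_neq (R[i]^o) 0; apply: filterS => nu; exact: e.
Qed.
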